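(* Let $C_{p,q}$ be the annulus with $p$ marked points on the outer and $q$ on the inner boundary, $T$ its fan triangulation, $Q$ the adjacency quiver of $T$ (a source-sink orientation of the $(p+q)$-cycle, with source and sink $s,t$), and $c$ the core curve, and let $t_c$ denote the Dehn twist along $c$. Then: (1) an arc $\gamma$ (essential, not in $T$) is bridging if and only if $M_\gamma$ is transjective, and peripheral if and only if $M_\gamma$ is regular; equivalently $$i(\gamma,c)=\bigl|\partial(\underline{\dim}\,M_\gamma)\bigr|\in\{0,1\};$$ (2) $t_c$ fixes every peripheral arc; for a bridging arc $\gamma$, each coordinate of $k\mapsto\underline{\dim}\,M_{t_c^{\,k}\gamma}$ ($k\in\mathbb{Z}$) is a $V$-shaped sequence of slopes $\mp1$ (possibly with a flat bottom), on each of the two arms of the orbit consecutive twists eventually add exactly $\delta$, and the two arms carry constant defect $+1$ and $-1$, respectively; (3) consequently, for the projection $\pi_{st}$ of $C(Q)$: the two off-diagonal lines $c_s-c_t=\pm1$ carry the bridging arcs, separated by the sign of the defect (the two arms of the twist orbits), and along each arm the Dehn twist realizes the $\delta$-shift filling the line; the diagonal $c_s=c_t$ carries only the finitely many arcs disjoint from the core.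
   Context: $Q$ is an acyclic quiver of type $\widetilde A_n$, $n+1=p+q$, with null root $\delta=(1,\dots,1)$. $C(Q)\subset\mathbb{Z}^{Q_0}$ denotes the set of all $c$-vectors of the cluster algebra with principal coefficients at the seed associated with $Q$; it is known that $C(Q)=\{\pm\beta:\beta\text{ the dimension vector of an exceptional (rigid, indecomposable) }kQ\text{-module}\}$, $k$ algebraically closed. $\pi_{st}(x)=(x_s,x_t)$. The defect is $\partial(x)=\langle\delta,x\rangle$ with Euler form $\langle x,y\rangle=\sum_i x_iy_i-\sum_{i\to j}x_iy_j$; here $\partial(x)=x_s-x_t$. An indecomposable module is preprojective, regular, preinjective according as the defect of its dimension vector is $<0,=0,>0$; transjective means preprojective or preinjective. Surface model. In the universal cover of $C_{p,q}$, identify the outer marked points with $\mathbb{Z}$ (reduction mod $p$) and the inner marked points with $\mathbb{Z}$ (reduction mod $q$), the deck transformation acting by $(a,b)\mapsto(a+p,b+q)$. An arc is bridging if it joins the two boundary components and peripheral otherwise. A bridging arc is determined by an endpoint pair $(a,b)$ up to the deck action, and two bridging arcs have minimal crossing number $i((a,b),(a',b'))=\#\{k\in\mathbb{Z}:(a-a'-kp)(b-b'-kq)<0\}$; in general $i(\cdot,\cdot)$ is the minimal (geometric) crossing number up to isotopy. The Dehn twist acts on bridging arcs by $(a,b)\mapsto(a+p,b)$. The fan triangulation $T$ consists of the bridging arcs $(j,0)$ for $0\le j\le p$ and $(p,j)$ for $1\le j\le q-1$; its adjacency quiver $Q$ is the source-sink orientation of the $(n+1)$-cycle (unique source, unique sink),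 with $s$ and $t$ the two arcs $(0,0)$ and $(p,0)$ shared by the outer and inner fans. Write $\tau_i$ for the arc of $T$ corresponding to $i\in Q_0$. Standard dictionary (taken as known): $\gamma\mapsto M_\gamma$, where $(\underline{\dim}\,M_\gamma)_i=i(\gamma,\tau_i)$, is a bijection between the essential arcs of $C_{p,q}$ not in $T$ and the exceptional indecomposable $kQ$-modules; an arc ''carried'' by a line of $\pi_{st}$ is one whose dimension vector $\underline{\dim}\,M_\gamma$ projects to that line. In (2), $\underline{\dim}\,M_{t_c^k\gamma}$ is understood as the vector of crossing numbers $(i(t_c^k\gamma,\tau_i))_i$ (equal to $0$ when $t_c^k\gamma\in T$); a $V$-shaped sequence of slopes $\mp1$ possibly with a flat bottom is one that decreases by $1$ per step, then is constant on a possibly trivial finite stretch, then increases by $1$ per step; the two arms of the orbit are its two ends, $k$ sufficiently large positive and $k$ sufficiently large negative (''add $\delta$'' being per twist moving outward along the arm). *)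

(* Defs.v *)
From HB Require Import structures.
From mathcomp Require Import all_boot all_order all_algebra.
From mathcomp Require Import all_classical all_reals all_analysis.
Import Order.TTheory GRing.Theory Num.Theory.
Import numFieldNormedType.Exports.

Set Implicit Arguments.
Unset Strict Implicit.
Unset Printing Implicit Defensive.

Local Open Scope classical_set_scope.
Local Open Scope card_scope.
Local Open Scope ring_scope.

(* Quivers and finite-dimensional representations.  Vectors are rows and
   linear maps act on the right, so composition reads from left to right. *)

Record quiver (n : nat) := Quiver {
  arrow : finType;
  src : arrow -> 'I_n;
  tgt : arrow -> 'I_n }.

Record rep (F : fieldType) n (Q : quiver n) := Rep {
  rdim : 'I_n -> nat;
  ract : forall a : arrow Q, 'M[F]_(rdim (src a), rdim (tgt a)) }.

Section Representations.
Variables (F : fieldType) (n : nat) (Q : quiver n).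
Implicit Types U V W E : rep F Q.

Definition is_hom V W (f : forall i, 'M[F]_(rdim V i, rdim W i)) : Prop :=
  forall a : arrow Q, ract V a *m f (tgt a) = f (src a) *m ract W a.

Definition isomorphic V W : Prop :=
  exists f : forall i, 'M[F]_(rdim V i, rdim W i),
    is_hom f /\ forall i, row_free (f i) && row_full (f i).

Definition dsum U W : rep F Q :=
  @Rep F n Q (fun i => rdim U i + rdim W i)%N
    (fun a => block_mx (ract U a) 0 0 (ract W a)).

Definition zero_rep V : Prop := forall i, rdim V i = 0%N.

Definition indecomposable V : Prop :=
  ~ zero_rep V /\
  forall U W, isomorphic V (dsum U W) -> zero_rep U \/ zero_rep W.

(* Ext^1(V, V) = 0: every short exact sequence 0 -> V -> E -> V -> 0 splits. *)
Definition rigid V : Prop :=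
  forall E (f : forall i, 'M[F]_(rdim V i, rdim E i))
           (g : forall i, 'M[F]_(rdim E i, rdim V i)),
    is_hom f -> is_hom g ->
    (forall i, [&& row_free (f i), row_full (g i) & (f i == kermx (g i))%MS]) ->
    exists h : forall i, 'M[F]_(rdim V i, rdim E i),
      is_hom h /\ forall i, h i *m g i = 1%:M.

Definition exceptional V : Prop := indecomposable V /\ rigid V.

Definition dimvec V : 'cV[int]_n := \col_i (rdim V i)%:Z.

Definition euler (x y : 'cV[int]_n) : int :=
  \sum_i x i 0 * y i 0 - \sum_(a : arrow Q) x (src a) 0 * y (tgt a) 0.

(* The null root of a quiver of type A~. *)
Definition delta : 'cV[int]_n := const_mx 1.

Definition defect (x : 'cV[int]_n) : int := euler delta x.

Definition preprojective V : Prop := indecomposable V /\ defect (dimvec V) < 0.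
Definition regular V : Prop := indecomposable V /\ defect (dimvec V) = 0.
Definition preinjective V : Prop := indecomposable V /\ 0 < defect (dimvec V).
Definition transjective V : Prop := preprojective V \/ preinjective V.

(* c-vectors: the columns of the lower halves C of the extended exchange
   matrices obtained by mutation from the principal one (B_Q, 1). *)

Definition exchange_matrix : 'M[int]_n :=
  \matrix_(i, j)
    ((#|[set a : arrow Q | (src a == i) && (tgt a == j)]%SET|)%:Z -
     (#|[set a : arrow Q | (src a == j) && (tgt a == i)]%SET|)%:Z).

Definition mutateB (k : 'I_n) (B : 'M[int]_n) : 'M[int]_n :=
  \matrix_(i, j)
    if (i == k) || (j == k) then - B i j
    else B i j + Num.sg (B i k) * Num.max (B i k * B k j) 0.

Definition mutateC (k : 'I_n) (B C : 'M[int]_n) : 'M[int]_n :=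
  \matrix_(i, j)
    if j == k then - C i j
    else C i j + Num.sg (C i k) * Num.max (C i k * B k j) 0.

Inductive reachable : 'M[int]_n -> 'M[int]_n -> Prop :=
| reach_init : reachable exchange_matrix 1%:M
| reach_step B C k : reachable B C -> reachable (mutateB k B) (mutateC k B C).

Definition c_vectors : set 'cV[int]_n :=
  [set v | exists B C j, reachable B C /\ v = col j C].

End Representations.

Arguments delta {n}.

(* The annulus C_{p,q} is the quotient of the strip R x [0, 1] by the
   translations (x, y) |-> (x + m, y), m : int.  The outer boundary is y = 1,
   with lifted marked points a / p, and the inner boundary is y = 0, with lifted
   marked points b / q; a translation by m sends a to a + m p and b to b + m q. *)

Inductive mpt := Outer of int | Inner of int.

Definition deck_mpt (p q : nat) (m : int) (x : mpt) : mpt :=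
  match x with
  | Outer a => Outer (a + m * p%:Z)
  | Inner b => Inner (b + m * q%:Z)
  end.

(* Action on lifted marked points of the m-th power of the Dehn twist along the
   core, whose lift is the shear (x, y) |-> (x + m y, y). *)
Definition twist_mpt (p : nat) (m : int) (x : mpt) : mpt :=
  match x with
  | Outer a => Outer (a + m * p%:Z)
  | Inner b => Inner b
  end.

(* The strip being simply connected, the homotopy class of an arc relative to
   its endpoints is determined by the endpoints of a lift. *)
Definition ann_arc := (mpt * mpt)%type.

Definition deck_arc p q m (g : ann_arc) : ann_arc :=
  (deck_mpt p q m g.1, deck_mpt p q m g.2).

Definition twist p m (g : ann_arc) : ann_arc := (twist_mpt p m g.1, twist_mpt p m g.2).

(* Arcs are unoriented, and lifts are taken up to deck translations. *)
Definition isotopic p q (g h : ann_arc) : Prop :=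
  exists m, h = deck_arc p q m g \/ h = deck_arc p q m (g.2, g.1).

Definition bridging (g : ann_arc) : bool :=
  match g with
  | (Outer _, Inner _) | (Inner _, Outer _) => true
  | _ => false
  end.

Definition peripheral (g : ann_arc) : bool := ~~ bridging g.

Inductive curve := Arc of ann_arc | Core.
Coercion Arc : ann_arc >-> curve.

Section Geometry.
Variables (R : realType) (p q : nat).

Definition mpos (x : mpt) : R * R :=
  match x with
  | Outer a => (a%:~R / p%:R, 1)
  | Inner b => (b%:~R / q%:R, 0)
  end.

Definition deck (m : int) (z : R * R) : R * R := (z.1 + m%:~R, z.2).

Definition shear (m : int) (z : R * R) : R * R := (z.1 + m%:~R * z.2, z.2).

Lemma deck_pos m x : (0 < p)%N -> (0 < q)%N ->
  deck m (mpos x) = mpos (deck_mpt p q m x).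
Proof.
by case: x => a p0 q0; rewrite /deck /= intrD intrM mulrDl -pmulrn mulfK // pnatr_eq0 -lt0n.
Qed.

Lemma shear_pos m x : (0 < p)%N -> shear m (mpos x) = mpos (twist_mpt p m x).
Proof.
case: x => a p0; rewrite /shear /= ?mulr0 ?addr0 //.
by rewrite mulr1 intrD intrM mulrDl -pmulrn mulfK // pnatr_eq0 -lt0n.
Qed.

(* The parameter values used to count intersections: the endpoints of an arc
   are discarded, and the base point of a closed curve is counted once. *)
Definition params (c : curve) : set R :=
  match c with
  | Arc _ => `]0, 1[%classic
  | Core => `[0, 1[%classic
  end.

(* f is a lift of a curve of the annulus that is simple, contained in the
   interior except possibly for its endpoints, and in the isotopy class c. *)
Definition represents (c : curve) (f : R -> R * R) : Prop :=
  [/\ {within `[0, 1], continuous f},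
      match c with
      | Arc g => f 0 = mpos g.1 /\ f 1 = mpos g.2
      | Core => f 1 = deck 1 (f 0)
      end,
      (forall u, params c u -> 0 < (f u).2 < 1) &
      (forall u v m, params c u -> params c v -> f u = deck m (f v) -> u = v)].

Definition crossings (c c' : curve) (f f' : R -> R * R) : set (R * R) :=
  [set z | [/\ params c z.1, params c' z.2 &
               exists m, f z.1 = deck m (f' z.2)]].

Definition crosses_in (c c' : curve) (n : nat) : Prop :=
  exists f f', [/\ represents c f, represents c' f' &
                   crossings c c' f f' #= `I_n].

(* Minimal number of crossings over the isotopy classes of c and c'; the default
   value 0 is only taken on classes without a simple representative. *)
Definition crossing (c c' : curve) : nat :=
  xget 0%N [set n | crosses_in c c' n /\ forall m, crosses_in c c' m -> (n <= m)%N].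

(* A simple arc that is neither contractible nor a boundary segment. *)
Definition essential (g : ann_arc) : Prop :=
  (exists f, represents g f) /\
  match g with
  | (Outer a, Outer b) | (Inner a, Inner b) => 1 < `|a - b|
  | _ => True
  end.

(* The arcs of the fan triangulation, listed cyclically: (0,0), (1,0), ...,
   (p,0), (p,1), ..., (p,q-1). *)
Definition fan (i : 'I_(p + q)) : ann_arc :=
  if (i <= p)%N then (Outer i%:Z, Inner 0) else (Outer p%:Z, Inner (i - p)%N%:Z).

Definition in_fan (g : ann_arc) : Prop := exists i, isotopic p q (fan i) g.

(* The triangle between the i-th and (i+1)-st arcs (indices mod p + q) gives one
   arrow; it is an outer triangle for i < p and an inner one otherwise.  The
   source is the arc (0,0) and the sink the arc (p,0). *)
Definition fan_quiver : quiver (p + q) :=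
  @Quiver (p + q) 'I_(p + q)
    (fun i => if (i < p)%N then i else ordS i)
    (fun i => if (i < p)%N then ordS i else i).

Definition crossv (g : ann_arc) : 'cV[int]_(p + q) := \col_i (crossing g (fan i))%:Z.

(* The dictionary between arcs and modules: M induces a bijection between
   isotopy classes of essential arcs outside the triangulation and isomorphism
   classes of exceptional modules, with crossing vectors as dimension vectors. *)
Record dictionary (F : fieldType) (M : ann_arc -> rep F fan_quiver) : Prop := {
  dict_exceptional : forall g, essential g -> ~ in_fan g -> exceptional (M g);
  dict_dim : forall g, essential g -> ~ in_fan g ->
    forall i, rdim (M g) i = crossing g (fan i);
  dict_iso : forall g h, essential g -> ~ in_fan g -> essential h -> ~ in_fan h ->
    (isomorphic (M g) (M h) <-> isotopic p q g h);
  dict_surj : forall V : rep F fan_quiver, exceptional V ->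
    exists g, [/\ essential g, ~ in_fan g & isomorphic (M g) V] }.

End Geometry.

Arguments mpos : clear implicits.

(* Slopes -1, then 0 on a possibly empty finite stretch, then +1. *)
Definition V_shaped (f : int -> int) : Prop :=
  exists m0 m1 : int, m0 <= m1 /\
    forall m, [/\ m < m0 -> f (m + 1) = f m - 1,
                  m0 <= m < m1 -> f (m + 1) = f m &
                  m1 <= m -> f (m + 1) = f m + 1].

Definition pi_st n (s t : 'I_n) (v : 'cV[int]_n) : int * int := (v s 0, v t 0).

(* The line c_s - c_t = e in the plane of the projection to (c_s, c_t). *)
Definition line (e : int) : set (int * int) := [set z | z.1 - z.2 = e].

(* Main.v *)
(* Everything reduces to crossing numbers on the annulus.  Two bridging arcs
   joining lifted endpoints must cross once for each deck translate whose
   endpoints interleave; straight segments achieve this number, which is the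
   number of integers strictly between (a - a') / p and (b - b') / q.  Twisting
   shifts the first bound by one, whence the V shape, and fan t is the twist of
   fan s, so that the (s, t)-coordinates are two consecutive values of the same
   V.  A peripheral arc is twist invariant, hence crosses fan s and fan t equally
   often, and it misses a core curve drawn close to the other boundary component.
   A simple peripheral arc cannot cross its own translate, so its endpoints are
   at most one turn apart: there are finitely many of them.  The forced crossings
   all come from Sperner's lemma applied to the grid of differences f u - g v. *)
Require Import Defs.
From mathcomp Require Import all_boot all_order all_algebra.
From mathcomp Require Import all_classical all_reals all_analysis.
From mathcomp Require Import zify ring lra.
Import Order.TTheory GRing.Theory Num.Theory.
Import numFieldNormedType.Exports.

Set Implicit Arguments.
Unset Strict Implicit.
Unset Printing Implicit Defensive.

Local Open Scope classical_set_scope.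
Local Open Scope card_scope.
Local Open Scope ring_scope.

(** * Sperner's lemma on a grid *)

(* A label (y, x) is read as A if y, as B if ~~ y && x and as C otherwise; an
   edge counts 1 from A to B and -1 from B to A.  Without a trichromatic triangle
   this is a closed discrete 1-form, so its sums along paths depend only on the
   endpoints. *)
Definition edge (l l' : bool * bool) : int :=
  ([&& l.1, ~~ l'.1 & l'.2] : nat)%:Z - ([&& l'.1, ~~ l.1 & l.2] : nat)%:Z.

Definition trichromatic (s : seq (bool * bool)) : bool :=
  [&& has (fun l => l.1) s, has (fun l => ~~ l.1 && l.2) s
    & has (fun l => ~~ l.1 && ~~ l.2) s].

Lemma edge_triangle l1 l2 l3 : ~~ trichromatic [:: l1; l2; l3] ->
  edge l1 l2 + edge l2 l3 = edge l1 l3.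
Proof. by case: l1 l2 l3 => [[] []] [[] []] [[] []]. Qed.

(** Both sides sum the 1-form over a boundary path of the rectangle from (0, 0) to (n, m). One path
    is pushed to the other across the triangles, column by column, and the form is closed on each of
    them. *)
Lemma sperner_grid (L : nat * nat -> bool * bool) n m :
  (forall i j, (i < n)%N -> (j < m)%N ->
     ~~ trichromatic [:: L (i, j); L (i.+1, j); L (i.+1, j.+1)] /\
     ~~ trichromatic [:: L (i, j); L (i, j.+1); L (i.+1, j.+1)]) ->
  \sum_(i < n) edge (L (i : nat, 0%N)) (L (i.+1, 0%N)) +
  \sum_(j < m) edge (L (n, j : nat)) (L (n, j.+1)) =
  \sum_(j < m) edge (L (0%N, j : nat)) (L (0%N, j.+1)) +
  \sum_(i < n) edge (L (i : nat, m)) (L (i.+1, m)).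
Proof.
move=> Ltri; have strip i k : (i < n)%N -> (k <= m)%N ->
    edge (L (i, 0%N)) (L (i.+1, 0%N)) + \sum_(j < k) edge (L (i.+1, j : nat)) (L (i.+1, j.+1)) =
    \sum_(j < k) edge (L (i, j : nat)) (L (i, j.+1)) + edge (L (i, k)) (L (i.+1, k)).
  move=> ltin; elim: k => [|k IHk] lekm; first by rewrite !big_ord0 addr0 add0r.
  have [/edge_triangle e1 /edge_triangle e2] := Ltri i k ltin lekm.
  by have := IHk (ltnW lekm); rewrite !big_ord_recr /=; lra.
have main k : (k <= n)%N ->
  \sum_(i < k) edge (L (i : nat, 0%N)) (L (i.+1, 0%N)) +
  \sum_(j < m) edge (L (k, j : nat)) (L (k, j.+1)) =
  \sum_(j < m) edge (L (0%N, j : nat)) (L (0%N, j.+1)) +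
  \sum_(i < k) edge (L (i : nat, m)) (L (i.+1, m)).
  elim: k => [|k IHk] lekn; first by rewrite !big_ord0 addr0 add0r.
  have := IHk (ltnW lekn); have := strip k m lekn (leqnn m).
  by rewrite !big_ord_recr /=; lra.
exact: main.
Qed.

Lemma edge_sum_top (l : nat -> bool * bool) n : (forall i, (i <= n)%N -> (l i).1) ->
  \sum_(i < n) edge (l i) (l i.+1) = 0.
Proof.
move=> lA; apply: big1 => i _.
by rewrite /edge !lA ?andbF //; exact: ltnW.
Qed.

(** An edge counts only if one of its ends is labelled A, and here A can occur only at the two
    extremities. *)
Lemma edge_sum_bottom (l : nat -> bool * bool) n :
  (forall i, (0 < i < n.+2)%N -> ~~ (l i).1) ->
  \sum_(i < n.+2) edge (l i) (l i.+1) = edge (l 0%N) (l 1%N) + edge (l n.+1) (l n.+2).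
Proof.
move=> lA; rewrite big_ord_recr big_ord_recl /= big1 ?addr0 // => i _.
rewrite /edge !(negPf (lA _ _)) ?andbF //= /bump /=.
  by rewrite ltnS; have := ltn_ord i; lia.
by have := ltn_ord i; lia.
Qed.

(** Label C is absent, so each edge is the change of the indicator of A and the sum telescopes. *)
Lemma edge_sum_right (l : nat -> bool * bool) n : (forall i, (i <= n)%N -> (l i).2) ->
  \sum_(i < n) edge (l i) (l i.+1) = ((l 0%N).1 : nat)%:Z - ((l n).1 : nat)%:Z.
Proof.
elim: n => [|n IHn] lB; first by rewrite big_ord0 subrr.
rewrite big_ord_recr /= IHn => [|i le_in]; last exact/lB/leqW.
by rewrite /edge !lB //; case: (l n).1; case: (l n.+1).1; case: (l 0%N).1.
Qed.

Lemma edge_sum_left (l : nat -> bool * bool) n : (forall i, (i <= n)%N -> ~~ (l i).2) ->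
  \sum_(i < n) edge (l i) (l i.+1) = 0.
Proof.
move=> lC; apply: big1 => i _.
by rewrite /edge !(negPf (lC _ _)) ?andbF //; exact: ltnW.
Qed.

(** * Forced crossings of plane paths *)

Section Chains.
Variable R : realType.
Implicit Types (P Q : nat -> R * R) (e : R).

Definition is_chain P n e := forall i, (i < n)%N ->
  `|(P i.+1).1 - (P i).1| <= e /\ `|(P i.+1).2 - (P i).2| <= e.

(** The signs of the coordinates of P i - Q j, vertical first: A means P is above (or level), B
    below and to the right, C below and to the left. *)
Definition side P Q (ij : nat * nat) : bool * bool :=
  ((Q ij.2).2 <= (P ij.1).2, (Q ij.2).1 <= (P ij.1).1).

(** Different boundary sums force a trichromatic triangle. Across a triangle each coordinate of P i
    - Q j varies by at most 2 e, one e for each chain. The vertex labelled A is the near meeting: B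
    bounds its vertical offset, B and C together its horizontal one. *)
Lemma chain_crossing P Q n m e : is_chain P n e -> is_chain Q m e ->
  \sum_(i < n) edge (side P Q (i : nat, 0%N)) (side P Q (i.+1, 0%N)) +
  \sum_(j < m) edge (side P Q (n, j : nat)) (side P Q (n, j.+1)) !=
  \sum_(j < m) edge (side P Q (0%N, j : nat)) (side P Q (0%N, j.+1)) +
  \sum_(i < n) edge (side P Q (i : nat, m)) (side P Q (i.+1, m)) ->
  exists i j, [/\ (i <= n)%N, (j <= m)%N, `|(P i).1 - (Q j).1| <= 2 * e
                & `|(P i).2 - (Q j).2| <= 2 * e].
Proof.
move=> Pe Qe; apply: contraPP => /forallNP far; apply/negP; rewrite negbK; apply/eqP.
have tri (s : seq (nat * nat)) :
    (forall a, a \in s -> (a.1 <= n)%N /\ (a.2 <= m)%N) ->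
    (forall a b, a \in s -> b \in s ->
       `|((P a.1).1 - (Q a.2).1) - ((P b.1).1 - (Q b.2).1)| <= 2 * e /\
       `|((P a.1).2 - (Q a.2).2) - ((P b.1).2 - (Q b.2).2)| <= 2 * e) ->
    ~~ trichromatic (map (side P Q) s).
  move=> sle sclose; apply/negP; rewrite /trichromatic !has_map => /and3P[].
  case/hasP => a sa /= a1; case/hasP => b sb /andP[/= b1 b2].
  case/hasP => c sc /andP[/= c1 c2].
  have [a1n a2m] := sle a sa.
  have [_ ab2] := sclose a b sa sb; have [ab1 _] := sclose a b sa sb.
  have [ac1 _] := sclose a c sa sc.
  have := far a.1; move/forallNP/(_ a.2); apply; split => //.
    by move: ab1 ac1 b2 c2; rewrite !ler_norml -!ltNge; lra.
  by move: ab2 a1 b1; rewrite !ler_norml -!ltNge; lra.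
apply: sperner_grid => i j ltin ltjm.
have [p1 p2] := Pe i ltin; have [q1 q2] := Qe j ltjm.
split; apply: (tri [:: (i, j); _; (i.+1, j.+1)]).
- by move=> a; rewrite !inE => /or3P[] /eqP -> /=; lia.
- move=> a b; rewrite !inE => /or3P[] /eqP -> /or3P[] /eqP -> /=;
  by move: p1 p2 q1 q2; rewrite !ler_norml; lra.
- by move=> a; rewrite !inE => /or3P[] /eqP -> /=; lia.
- move=> a b; rewrite !inE => /or3P[] /eqP -> /or3P[] /eqP -> /=;
  by move: p1 p2 q1 q2; rewrite !ler_norml; lra.
Qed.

End Chains.

(** * Sperner's lemma on a grid *)

Section Paths.
Variable R : realType.
Implicit Types (f g h : R -> R * R) (u v e : R).

(** This is uniform continuity, by compactness of the unit interval. The number of steps has the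
    form n.+2 so that the first and last edges are distinct, as in [edge_sum_bottom]. *)
Lemma path_chain f e : {within `[0, 1], continuous f} -> 0 < e ->
  exists n, is_chain (fun i => f (i%:R / n.+2%:R)) n.+2 e.
Proof.
move=> /subspace_continuousP fc e0.
have fd : \forall d \near 0^'+, `[0, 1]%classic `<=` [set x : R | forall y, `[0, 1]%classic x ->
    `[0, 1]%classic y -> `|x - y| < d -> `|(f y).1 - (f x).1| <= e /\ `|(f y).2 - (f x).2| <= e].
  have /compact_near_coveringP := @segment_compact R 0 1; apply => x x01.
  have /cvgrPdist_lt /(_ (e / 2)) := fc x x01; rewrite divr_gt0 // => /(_ isT).
  rewrite near_withinE => /nbhs_ballP[r /= r0 fr].
  near=> z d => /= y z01 y01 zyd.
  have xz : `|x - z| < r / 2 by near: z; apply: nbhsx_ballx; rewrite divr_gt0.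
  have dr : d < r / 2 by near: d; apply: nbhs_right_lt; rewrite divr_gt0.
  have /fr/(_ z01) : ball x r z by rewrite /ball /= (lt_trans xz) // ltr_pdivrMr //; lra.
  have /fr/(_ y01) : ball x r y.
    rewrite /ball /= -(subrK z x) -addrA (le_lt_trans (ler_normD _ _)) //.
    by move: (lt_trans zyd dr) xz; lra.
  rewrite /= /Num.norm /= !gt_max => /andP[y1 y2] /andP[z1 z2].
  by move: y1 y2 z1 z2; rewrite !ltr_norml !ler_norml; lra.
have [d [d0 {}fd]] := filter_ex (filterI (nbhs_right_gt 0) fd).
pose n := Num.bound d^-1; exists n => i ltin.
have n0 : 0 < n.+2%:R :> R by [].
have dn : 1 < d * n.+2%:R.
  rewrite -ltr_pdivrMl // mulr1; have dv : 0 <= d^-1 by rewrite invr_ge0 ltW.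
  by apply: lt_le_trans (archi_boundP dv) _; rewrite ler_nat /n; lia.
have step : `|i%:R / n.+2%:R - i.+1%:R / n.+2%:R : R| < d.
  by rewrite -mulrBl -opprB -natrB // subSnn normrM normrN1 mul1r gtr0_norm ?invr_gt0 //
             -div1r ltr_pdivrMr.
apply: fd step; rewrite /= in_itv /= ?divr_ge0 ?ler_pdivrMr ?mul1r ?ler_nat //.
all: by rewrite ?andTb ltnW.
Unshelve. all: end_near. Qed.

(** The differences f u - g v form a compact, hence closed, set. If it misses the points (k, 0),
    then, [ks] being finite, one e keeps it away from all of them. *)
Lemma paths_meet f g (ks : seq int) :
  {within `[0, 1], continuous f} -> {within `[0, 1], continuous g} ->
  (forall e, 0 < e -> exists u v k, [/\ 0 <= u <= 1, 0 <= v <= 1, k \in ks,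
     `|(f u).1 - ((g v).1 + k%:~R)| <= e & `|(f u).2 - (g v).2| <= e]) ->
  exists u v k, [/\ 0 <= u <= 1, 0 <= v <= 1, k \in ks & f u = deck k (g v)].
Proof.
move=> fc gc near_meet; apply: contrapT => nomeet.
pose D (z : (R * R) * (R * R)) : R * R := z.1 - z.2.
pose K := D @` ((f @` `[0, 1]) `*` (g @` `[0, 1])).
have Kclosed : closed K.
  apply: compact_closed; first exact: norm_hausdorff.
  apply: continuous_compact.
    by apply: continuous_subspaceT => z; apply: cvgB; [exact: cvg_fst|exact: cvg_snd].
  by apply: compact_setX; apply: continuous_compact => //; exact: segment_compact.
have KN k : k \in ks -> ~ K (k%:~R, 0).
  move=> kks; case=> -[_ _] [[/= u u01 <-] [v v01 <-]] [/eqP e1 /eqP e2].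
  apply: nomeet; exists u, v, k; split=> //.
  move: e1 e2; rewrite subr_eq subr_eq add0r => /eqP e1 /eqP e2.
  by rewrite /deck (surjective_pairing (f u)) e1 e2 addrC.
have [e e0 eK] : exists2 e, 0 < e & forall k, k \in ks -> forall z, K z ->
    ~ (`|z.1 - k%:~R| <= e /\ `|z.2| <= e).
  elim: ks KN {nomeet near_meet} => [|k ks IHks] KN; first by exists 1.
  have [|e e0 eK] := IHks; first by move=> l lks; apply: KN; rewrite inE lks orbT.
  have /nbhs_ballP[r /= r0 rK] : nbhs ((k%:~R, 0) : R * R) (~` K).
    by apply: open_nbhs_nbhs; split; [exact: closed_openC|by apply: KN; rewrite inE eqxx].
  exists (Num.min e (r / 2)); first by rewrite lt_min e0 divr_gt0.
  have rr : r / 2 < r by rewrite ltr_pdivrMr //; lra.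
  move=> l; rewrite inE => /predU1P[->|lks] z Kz [].
    rewrite !le_min => /andP[_ z1] /andP[_ z2]; apply: (rK z) => //.
    by split; rewrite /ball /= distrC ?subr0 (le_lt_trans _ rr).
  rewrite !le_min => /andP[z1 _] /andP[z2 _].
  exact: (eK l lks z Kz).
have [u [v [k [u01 v01 kks d1 d2]]]] := near_meet e e0.
apply: (eK k kks (f u - g v)).
  by exists (f u, g v) => //; split; [exists u|exists v] => //=; rewrite in_itv.
by split => //=; rewrite -addrA -opprD.
Qed.

End Paths.

(** * Sperner's lemma on a grid *)

Section Crossing.
Variable R : realType.
Implicit Types (f g h : R -> R * R) (u v e c : R).

Lemma unit_itvP u : 0 <= u <= 1 -> [\/ u = 0, u = 1 | 0 < u < 1].
Proof.
move=> /andP[]; rewrite le_eqVlt => /predU1P[<-|u0]; first by constructor 1.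
rewrite le_eqVlt => /predU1P[->|u1]; first by constructor 2.
by constructor 3; rewrite u0.
Qed.

Lemma node_itv (i n : nat) : (0 < i < n.+2)%N -> 0 < (i%:R / n.+2%:R : R) < 1.
Proof. by case/andP=> i0 iltn; rewrite divr_gt0 ?ltr0n // ltr_pdivrMr // mul1r ltr_nat. Qed.

Lemma node_itvcc (i n : nat) : (i <= n.+2)%N -> 0 <= (i%:R / n.+2%:R : R) <= 1.
Proof. by move=> len; rewrite divr_ge0 //= ler_pdivrMr // mul1r ler_nat. Qed.

(** When f starts to the left of g, the boundary sums of the sampled paths are -1 and 0. The only
    edge that counts is the last step of g seen from f 1: it goes from B to A because g ends to the
    left of f. *)
Lemma opposite_paths_cross f g c0 c1 :
  {within `[0, 1], continuous f} -> {within `[0, 1], continuous g} ->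
  (f 0).2 = c1 -> (g 0).2 = c1 -> (f 1).2 = c0 -> (g 1).2 = c0 ->
  (forall u, 0 < u < 1 -> c0 < (f u).2 < c1) ->
  (forall v, 0 < v < 1 -> c0 < (g v).2 < c1) ->
  ((f 0).1 - (g 0).1) * ((f 1).1 - (g 1).1) < 0 ->
  exists u v, [/\ 0 < u < 1, 0 < v < 1 & f u = g v].
Proof.
wlog lt0 : f g / (f 0).1 < (g 0).1.
  move=> hw fc gc f0 g0 f1 g1 fi gi opp.
  have [lt0|lt0|eq0] := ltgtP (f 0).1 (g 0).1; first exact: (hw f g).
    have [|u [v [u01 v01 uv]]] := hw g f lt0 gc fc g0 f0 g1 f1 gi fi.
      by rewrite -mulrNN !opprB.
    by exists v, u.
  by move: opp; rewrite eq0 subrr mul0r ltxx.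
move=> fc gc f0 g0 f1 g1 fi gi opp.
have lt1 : (g 1).1 < (f 1).1.
  by move: opp; rewrite nmulr_rlt0 ?subr_lt0 // subr_gt0.
have c01 : c0 < c1.
  have : 0 < (1 / 2 : R) < 1 by lra.
  by move=> /fi /andP[]; exact: lt_trans.
have [e e0|u [v [k [u01 v01 k0 uv]]]] := @paths_meet _ f g [:: 0] fc gc.
  (* The bound e / 2 compensates the factor 2 in [chain_crossing]; the others keep the samples next
     to an endpoint on the correct side of the other path's endpoint. *)
  pose d := Num.min (e / 2) (Num.min (((g 0).1 - (f 0).1) / 2) (((f 1).1 - (g 1).1) / 2)).
  have [d0 de d1 d2] : [/\ 0 < d, 2 * d <= e, d < (g 0).1 - (f 0).1 & d < (f 1).1 - (g 1).1].
    have h1 : d <= e / 2 by rewrite /d !ge_min lexx.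
    have h2 : d <= ((g 0).1 - (f 0).1) / 2 by rewrite /d !ge_min lexx ?orbT.
    have h3 : d <= ((f 1).1 - (g 1).1) / 2 by rewrite /d !ge_min lexx ?orbT.
    split; [|lra|lra|lra].
    by rewrite /d !lt_min !divr_gt0 // subr_gt0.
  have [n fd] := path_chain fc d0; have [m gd] := path_chain gc d0.
  set P := (fun i => _) in fd; set Q := (fun i => _) in gd.
  have P0 : P 0%N = f 0 by rewrite /P mul0r.
  have Q0 : Q 0%N = g 0 by rewrite /Q mul0r.
  have P1 : P n.+2 = f 1 by rewrite /P divff.
  have Q1 : Q m.+2 = g 1 by rewrite /Q divff.
  have Pi i : (0 < i < n.+2)%N -> c0 < (P i).2 < c1 by move=> /node_itv/fi.
  have Qi i : (0 < i < m.+2)%N -> c0 < (Q i).2 < c1 by move=> /node_itv/gi.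
  have [|i [j [lein lejm ij1 ij2]]] := chain_crossing fd gd.
    rewrite (edge_sum_bottom (l := fun i => side P Q (i, 0%N))); last first.
      by move=> i /Pi /andP[_]; rewrite /side /= Q0 g0 -ltNge.
    rewrite (edge_sum_bottom (l := fun j => side P Q (n.+2, j))); last first.
      by move=> j /Qi /andP[+ _]; rewrite /side /= P1 f1 -ltNge.
    rewrite (edge_sum_top (l := fun j => side P Q (0%N, j))); last first.
      move=> j jm; rewrite /side /= P0 f0; have /unit_itvP[j0|j1|/gi/andP[_ /ltW] //] := node_itvcc jm.
        by rewrite /Q j0 g0.
      by rewrite /Q j1 g1 ltW.
    rewrite (edge_sum_top (l := fun i => side P Q (i, m.+2))); last first.
      move=> i im; rewrite /side /= Q1 g1; have /unit_itvP[i0|i1|/fi/andP[/ltW //]] := node_itvcc im.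
        by rewrite /P i0 f0 ltW.
      by rewrite /P i1 f1.
    have /fd[p1 _] : (0 < n.+2)%N by [].
    have /gd[q1 _] : (m.+1 < m.+2)%N by [].
    have /Pi/andP[_ p2] : (0 < 1 < n.+2)%N by [].
    have /Pi/andP[_ p3] : (0 < n.+1 < n.+2)%N by rewrite ltnSn.
    have /Qi/andP[q2 _] : (0 < 1 < m.+2)%N by [].
    have /Qi/andP[q3 _] : (0 < m.+1 < m.+2)%N by rewrite ltnSn.
    move: p1 q1; rewrite P0 Q1 !ler_norml => /andP[_ p1] /andP[q1 _].
    rewrite /edge /side /= P1 Q1 Q0 g0 P0 f0 f1 g1.
    rewrite !(lt_geF p2) !(lt_geF p3) !(lt_geF q2) !(lt_geF q3) !(lt_geF c01) /=.
    have -> : ((g 0).1 <= (P 1%N).1) = false by apply/negbTE; rewrite -ltNge; lra.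
    have -> : ((Q m.+1).1 <= (f 1).1) by lra.
    by rewrite !lexx.
  exists (i%:R / n.+2%:R), (j%:R / m.+2%:R), 0.
  by rewrite !node_itvcc // inE eqxx mulr0z addr0; split => //; apply: le_trans de.
have {}uv : f u = g v by move: k0; rewrite uv inE /deck => /eqP ->; rewrite mulr0z addr0; case: (g v).
(* A meeting at an endpoint is excluded by the heights, or by the order of the endpoints when both
   paths are at the same end. *)
have [fu|fu|{}u01] := unit_itvP u01; have [gv|gv|{}v01] := unit_itvP v01;
  rewrite ?fu ?gv in uv.
- by move: lt0; rewrite uv ltxx.
- by move: c01; rewrite -f0 uv g1 ltxx.
- by have /andP[_] := gi _ v01; rewrite -uv f0 ltxx.
- by move: c01; rewrite -g0 -uv f1 ltxx.
- by move: lt1; rewrite uv ltxx.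
- by have /andP[+ _] := gi _ v01; rewrite -uv f1 ltxx.
- by have /andP[_] := fi _ u01; rewrite uv g0 ltxx.
- by have /andP[+ _] := fi _ u01; rewrite uv g1 ltxx.
- by exists u, v.
Qed.

(** Again the boundary sums are -1 and 0. The only edge that counts is the last step of f seen from
    g 0: it goes from B to A because f 1 is to the right of g 0, whereas seen from g 1 the same step
    starts from C. *)
Lemma interleaved_paths_cross f g c :
  {within `[0, 1], continuous f} -> {within `[0, 1], continuous g} ->
  (f 0).2 = c -> (f 1).2 = c -> (g 0).2 = c -> (g 1).2 = c ->
  (forall u, 0 < u < 1 -> (f u).2 < c) ->
  (forall v, 0 < v < 1 -> (g v).2 < c) ->
  (f 0).1 < (g 0).1 -> (g 0).1 < (f 1).1 -> (f 1).1 < (g 1).1 ->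
  exists u v, [/\ 0 < u < 1, 0 < v < 1 & f u = g v].
Proof.
move=> fc gc f0 f1 g0 g1 fi gi lt1 lt2 lt3.
have [e e0|u [v [k [u01 v01 k0 uv]]]] := @paths_meet _ f g [:: 0] fc gc.
  pose d := Num.min (e / 2) (Num.min (((g 0).1 - (f 0).1) / 2)
    (Num.min (((f 1).1 - (g 0).1) / 2) (((g 1).1 - (f 1).1) / 2))).
  have [d0 de d1 d2 d3] : [/\ 0 < d, 2 * d <= e, d < (g 0).1 - (f 0).1,
      d < (f 1).1 - (g 0).1 & d < (g 1).1 - (f 1).1].
    have h1 : d <= e / 2 by rewrite /d !ge_min lexx.
    have h2 : d <= ((g 0).1 - (f 0).1) / 2 by rewrite /d !ge_min lexx ?orbT.
    have h3 : d <= ((f 1).1 - (g 0).1) / 2 by rewrite /d !ge_min lexx ?orbT.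
    have h4 : d <= ((g 1).1 - (f 1).1) / 2 by rewrite /d !ge_min lexx ?orbT.
    split; [|lra|lra|lra|lra].
    by rewrite /d !lt_min !divr_gt0 // subr_gt0.
  have [n fd] := path_chain fc d0; have [m gd] := path_chain gc d0.
  set P := (fun i => _) in fd; set Q := (fun i => _) in gd.
  have P0 : P 0%N = f 0 by rewrite /P mul0r.
  have Q0 : Q 0%N = g 0 by rewrite /Q mul0r.
  have P1 : P n.+2 = f 1 by rewrite /P divff.
  have Q1 : Q m.+2 = g 1 by rewrite /Q divff.
  have Pi i : (0 < i < n.+2)%N -> (P i).2 < c by move=> /node_itv/fi.
  have [|i [j [lein lejm ij1 ij2]]] := chain_crossing fd gd.
    rewrite (edge_sum_bottom (l := fun i => side P Q (i, 0%N))); last first.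
      by move=> i /Pi; rewrite /side /= Q0 g0 -ltNge.
    rewrite (edge_sum_bottom (l := fun i => side P Q (i, m.+2))); last first.
      by move=> i /Pi; rewrite /side /= Q1 g1 -ltNge.
    have Qle j : (j <= m.+2)%N -> (Q j).2 <= c.
      move=> jm; have /unit_itvP[j0|j1|/gi/ltW //] := node_itvcc jm.
        by rewrite /Q j0 g0.
      by rewrite /Q j1 g1.
    rewrite (edge_sum_top (l := fun j => side P Q (0%N, j))); last first.
      by move=> j /Qle; rewrite /side /= P0 f0.
    rewrite (edge_sum_top (l := fun j => side P Q (n.+2, j))); last first.
      by move=> j /Qle; rewrite /side /= P1 f1.
    have /fd[p1 _] : (0 < n.+2)%N by [].
    have /fd[p4 _] : (n.+1 < n.+2)%N by [].
    have /Pi p2 : (0 < 1 < n.+2)%N by [].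
    have /Pi p3 : (0 < n.+1 < n.+2)%N by rewrite ltnSn.
    move: p1 p4; rewrite P0 P1 !ler_norml => /andP[p0 p1] /andP[p4 p5].
    rewrite /edge /side /= P1 P0 Q0 Q1 f0 f1 g0 g1 !lexx.
    rewrite !(lt_geF p2) !(lt_geF p3) /=.
    have -> : ((g 0).1 <= (P 1%N).1) = false by apply/negbTE; rewrite -ltNge; lra.
    have -> : ((g 1).1 <= (P 1%N).1) = false by apply/negbTE; rewrite -ltNge; lra.
    have -> : ((g 0).1 <= (P n.+1).1) by lra.
    by have -> : ((g 1).1 <= (P n.+1).1) = false by apply/negbTE; rewrite -ltNge; lra.
  exists (i%:R / n.+2%:R), (j%:R / m.+2%:R), 0.
  by rewrite !node_itvcc // inE eqxx mulr0z addr0; split => //; apply: le_trans de.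
have {}uv : f u = g v by move: k0; rewrite uv inE /deck => /eqP ->; rewrite mulr0z addr0; case: (g v).
have [fu|fu|{}u01] := unit_itvP u01; have [gv|gv|{}v01] := unit_itvP v01;
  rewrite ?fu ?gv in uv.
- by move: lt1; rewrite uv ltxx.
- by move: (lt_trans lt1 (lt_trans lt2 lt3)); rewrite uv ltxx.
- by have := gi _ v01; rewrite -uv f0 ltxx.
- by move: lt2; rewrite uv ltxx.
- by move: lt3; rewrite uv ltxx.
- by have := gi _ v01; rewrite -uv f1 ltxx.
- by have := fi _ u01; rewrite uv g0 ltxx.
- by have := fi _ u01; rewrite uv g1 ltxx.
- by exists u, v.
Qed.

End Crossing.

(** * Sperner's lemma on a grid *)

Section CrossingCore.
Variable R : realType.
Implicit Types (f g h : R -> R * R) (u v e c : R).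

Lemma path_bounded f : {within `[0, 1], continuous f} ->
  exists C : nat, forall u, 0 <= u <= 1 -> `|(f u).1| <= C%:R.
Proof.
move=> fc; have fK : compact (f @` `[0, 1]).
  by apply: continuous_compact => //; exact: segment_compact.
have [M [_ fM]] := compact_bounded fK.
exists (Num.bound `|M + 1|) => u u01.
have : `|f u| <= M + 1.
  by apply: fM; [rewrite ltrDl|exists u => //=; rewrite in_itv].
rewrite /Num.norm /= ge_max => /andP[le1 _]; apply: le_trans le1 _.
by apply: le_trans (ler_norm _) (ltW (archi_boundP _)).
Qed.

(* Samples of the lift of a loop match up at the ends of a period, so no
   continuity of the periodic extension is needed. *)
Lemma periodic_chain h n N L e : n = N.+2 -> is_chain (fun i => h (i%:R / n%:R)) n e ->
  h 1 = deck 1 (h 0) ->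
  forall M, is_chain (fun j => deck ((j %/ n)%N%:Z - L) (h ((j %% n)%N%:R / n%:R))) M e.
Proof.
move=> nN he h1 M j _; have n0 : (0 < n)%N by rewrite nN.
have [+ +] := he (j %% n)%N (ltn_pmod j n0); rewrite divnS // modnS.
have [dj|ndj] := boolP (n %| j.+1)%N.
  have -> : (j %% n).+1 = n.
    move: dj; rewrite (divn_eq j n) -addnS dvdn_addr ?dvdn_mull // => /dvdn_leq.
    by rewrite modnMDl modn_mod => /(_ isT); have := ltn_pmod j n0; lia.
  rewrite divff ?pnatr_eq0 -?lt0n // mul0r h1 /deck /= add1n -addn1 PoszD => a1 a2.
  split => //; rewrite -addrA [_%:Z + 1 - L]addrAC intrD addrA.
  by move: a1; rewrite !intrD; congr (`| _ | <= _); ring.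
rewrite add0n /deck /= => a1 a2; split => //.
by move: a1; congr (`| _ | <= _); ring.
Qed.

(** A long enough piece of the lifted loop starts to the left of all of f and ends to its right.
    Seen from its start, f descends from A to B, which contributes 1; the other three sides of the
    grid contribute 0. *)
Lemma essential_loop_cross f h :
  {within `[0, 1], continuous f} -> {within `[0, 1], continuous h} ->
  (f 0).2 = 1 -> (f 1).2 = 0 -> h 1 = deck 1 (h 0) ->
  (forall v, 0 <= v <= 1 -> 0 < (h v).2 < 1) ->
  exists u v k, [/\ 0 < u < 1, 0 <= v < 1 & f u = deck k (h v)].
Proof.
move=> fc hc f0 f1 h1 hi.
have [C1 fC1] := path_bounded fc; have [C2 hC2] := path_bounded hc.
(* The loop is followed over 2 L periods, from translate -L to translate L; this value of L takes it
   past f on both sides by at least 1. *)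
have [L LE] : exists L, L = (C1 + C2).+1 by exists (C1 + C2).+1.
pose ks := [seq i%:Z - L%:Z | i <- iota 0 (L + L).+1].
have [e e0|u [v [k [u01 v01 _ uv]]]] := @paths_meet _ f h ks fc hc.
  have d0 : 0 < e / 2 by rewrite divr_gt0.
  have [n fd] := path_chain fc d0; have [m hd] := path_chain hc d0.
  set P := (fun i => _) in fd.
  have gd := periodic_chain L%:Z (M := ((L + L) * m.+2)%N) erefl hd h1.
  set Q := (fun i => _) in gd.
  have P0 : P 0%N = f 0 by rewrite /P mul0r.
  have P1 : P n.+2 = f 1 by rewrite /P divff.
  have Pb i : (i <= n.+2)%N -> `|(P i).1| <= C1%:R by move=> /node_itvcc/fC1.
  have Qj j : 0 <= ((j %% m.+2)%N%:R / m.+2%:R : R) <= 1.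
    by rewrite node_itvcc // ltnW // ltn_pmod.
  have Q0 : (Q 0%N).1 <= - (C1%:R + 1).
    rewrite /Q /= mod0n div0n /= mul0r add0r intrN -pmulrn LE.
    have := hC2 0; rewrite lexx ler01 => /(_ isT); rewrite ler_norml => /andP[_].
    by rewrite -addn1 !natrD; lra.
  have QM : C1%:R + 1 <= (Q ((L + L) * m.+2)%N).1.
    rewrite /Q /= modnMl mulnK // mul0r PoszD addrK -pmulrn LE.
    have := hC2 0; rewrite lexx ler01 => /(_ isT); rewrite ler_norml => /andP[+ _].
    by rewrite -addn1 !natrD; lra.
  have Qi j : 0 < (Q j).2 < 1 by exact: hi (Qj j).
  have QE j : Q j = deck ((j %/ m.+2)%N%:Z - L%:Z) (h ((j %% m.+2)%N%:R / m.+2%:R)) by [].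
  have PE i : P i = f (i%:R / n.+2%:R) by [].
  clearbody P Q; have Q_gt0 j := proj1 (andP (Qi j)); have Q_lt1 j := proj2 (andP (Qi j)).
  have [|i [j [lein lejm ij1 ij2]]] := chain_crossing fd gd.
    rewrite (edge_sum_right (l := fun i => side P Q (i, 0%N))); last first.
      by move=> i /Pb; rewrite /side /= ler_norml => /andP[p _]; move: p Q0; lra.
    rewrite (edge_sum_left (l := fun i => side P Q (i, ((L + L) * m.+2)%N))); last first.
      by move=> i /Pb; rewrite /side /= -ltNge ler_norml => /andP[_ p]; move: p QM; lra.
    rewrite (edge_sum_top (l := fun j => side P Q (0%N, j))); last first.
      by move=> j _; rewrite /side /= P0 f0 ltW.
    rewrite (_ : \sum_(j < _) edge _ _ = 0); last first.
      by apply: big1 => j _; rewrite /edge /side /= P1 f1 !(lt_geF (Q_gt0 _)).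
    by rewrite /side /= P1 P0 f0 f1 (lt_geF (Q_gt0 _)) (ltW (Q_lt1 _)).
  exists (i%:R / n.+2%:R), ((j %% m.+2)%N%:R / m.+2%:R), ((j %/ m.+2)%N%:Z - L%:Z).
  rewrite node_itvcc // Qj; split => //.
  - apply/mapP; exists (j %/ m.+2)%N => //; rewrite mem_iota /= add0n ltnS.
    by rewrite -(mulnK (L + L) (ltn0Sn m.+1)) leq_div2r.
  - by move: ij1; rewrite PE QE /= => ij1; apply: le_trans ij1 _; lra.
  - by move: ij2; rewrite PE QE /= => ij2; apply: le_trans ij2 _; lra.
have ui : 0 < u < 1.
  have [hu|hu|//] := unit_itvP u01.
    by have /andP[_] := hi v v01; have := congr1 snd uv; rewrite hu f0 /= => <-; rewrite ltxx.
  by have /andP[+ _] := hi v v01; have := congr1 snd uv; rewrite hu f1 /= => <-; rewrite ltxx.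
(* The base point of the loop is counted at v = 0 only, so a meeting at v = 1 is moved to v = 0 on
   the next translate. *)
have [hv|hv|/andP[/ltW v0 v1]] := unit_itvP v01.
- by exists u, 0, k; rewrite lexx ltr01 uv hv.
- exists u, 0, (1 + k); rewrite lexx ltr01; split => //.
  by rewrite uv hv h1 /deck /= intrD addrA.
- by exists u, v, k; rewrite v0.
Qed.

End CrossingCore.

(** * Invariance of crossing numbers *)

(** * Sperner's lemma on a grid *)

Section Invariance.
Variables (R : realType) (p q : nat) (p_gt0 : (0 < p)%N) (q_gt0 : (0 < q)%N).
Implicit Types (f : R -> R * R) (g h : ann_arc) (c d : curve) (m k : int) (z w : R * R).

Definition reversed g : ann_arc := (g.2, g.1).

Lemma deck_inj m : injective (@deck R m).
Proof. by move=> [a b] [a' b'] [/= /addIr -> ->]. Qed.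

Lemma deckD m k z : deck m (deck k z) = deck (k + m) z.
Proof. by rewrite /deck /= intrD addrA. Qed.

Lemma shear_inj m : injective (@shear R m).
Proof. by move=> [a b] [a' b'] [/= + bE]; rewrite bE => /addIr ->. Qed.

Lemma shear_deck m k z : shear m (deck k z) = deck k (shear m z).
Proof. by rewrite /shear /deck /= addrAC. Qed.

Lemma pair_continuous (T : topologicalType) (a b : T -> R) :
  continuous a -> continuous b -> continuous (fun x => (a x, b x)).
Proof. by move=> ca cb x; exact: cvg_pair (ca x) (cb x). Qed.

Lemma deck_continuous m : continuous (@deck R m).
Proof.
apply: pair_continuous => z; last exact: cvg_snd.
by apply: cvgD; [exact: cvg_fst|exact: cvg_cst].
Qed.

Lemma shear_continuous m : continuous (@shear R m).
Proof.
apply: pair_continuous => z; last exact: cvg_snd.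
apply: cvgD; first exact: cvg_fst.
by apply: cvgM; [exact: cvg_cst|exact: cvg_snd].
Qed.

Lemma within_comp (T : topologicalType) (phi : R * R -> T) f : continuous phi ->
  {within `[0, 1], continuous f} -> {within `[0, 1], continuous (phi \o f)}.
Proof. by move=> phic; apply: within_continuous_comp => z _; exact: phic. Qed.

Lemma within_comp_onem (T : topologicalType) (f : R -> T) :
  {within `[0, 1], continuous f} -> {within `[0, 1], continuous (fun u => f (1 - u))}.
Proof.
move=> /subspace_continuousP fc; apply/subspace_continuousP => u u01.
have v01 : `[0, 1]%classic (1 - u).
  by move: u01; rewrite /= !in_itv /= => /andP[u0 u1]; apply/andP; split; lra.
apply: cvg_comp (fc _ v01) => A /= /nbhs_ballP[r /= r0 rA]; apply/nbhs_ballP; exists r => //= y uy y01.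
apply: rA.
  by move: uy; rewrite /ball /= distrC; congr (`| _ | < _); ring.
by move: y01; rewrite !in_itv /= => /andP[y0 y1]; apply/andP; split; lra.
Qed.

Lemma represents_reversed g f : represents p q g f -> represents p q (reversed g) (fun u => f (1 - u)).
Proof.
move=> [fc [f0 f1] fi fs]; split; first exact: within_comp_onem.
- by rewrite subr0 subrr.
- move=> u; rewrite /= in_itv /= => /andP[u0 u1]; apply: fi; rewrite /= in_itv /=.
  by apply/andP; split; lra.
- move=> u v m; rewrite /= !in_itv /= => /andP[u0 u1] /andP[v0 v1] e.
  suff: 1 - u = 1 - v by lra.
  by apply: fs e; rewrite /= in_itv /=; apply/andP; split; lra.
Qed.

Lemma represents_deck g f m : represents p q g f ->
  represents p q (deck_arc p q m g) (deck m \o f).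
Proof.
move=> [fc [f0 f1] fi fs]; split => //.
- by apply: within_comp fc; exact: deck_continuous.
- by rewrite /= f0 f1 !deck_pos.
- by move=> u v k up vp /= e; apply: (fs _ _ k) => //; apply: (@deck_inj m); rewrite e !deckD addrC.
Qed.

Lemma represents_twist g f m : represents p q g f ->
  represents p q (twist p m g) (shear m \o f).
Proof.
move=> [fc [f0 f1] fi fs]; split => //.
- by apply: within_comp fc; exact: shear_continuous.
- by rewrite /= f0 f1 !shear_pos.
- by move=> u v k up vp /= e; apply: (fs _ _ k) => //; apply: (@shear_inj m); rewrite e shear_deck.
Qed.

Lemma eq_crossing c c' d d' :
  (forall n, crosses_in R p q c c' n <-> crosses_in R p q d d' n) ->
  crossing R p q c c' = crossing R p q d d'.
Proof.
move=> e; have {}e : crosses_in R p q c c' = crosses_in R p q d d'.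
  by apply/funext => n; apply/propext.
by rewrite /crossing e.
Qed.

Lemma crossing_reversed g c : crossing R p q (reversed g) c = crossing R p q g c.
Proof.
have half g' n : crosses_in R p q g' c n -> crosses_in R p q (reversed g') c n.
  move=> [f [f' [fr f'r fn]]]; exists (fun u => f (1 - u)), f'; split => //.
    exact: represents_reversed.
  apply: card_eq_trans fn.
  rewrite (_ : crossings _ _ _ _ = (fun z => (1 - z.1, z.2)) @` crossings g' c f f').
    by apply: inj_card_eq => -[a b] [a' b'] _ _ [/addrI/oppr_inj -> ->].
  apply/seteqP; split=> [[u v] [/= up vp [m e]]|_ [[u v] [/= up vp [m e]] <-]].
    exists (1 - u, v); last by rewrite /= opprB addrC subrK.
    split => //=; last by exists m.
    by move: up; rewrite !in_itv /= => /andP[u0 u1]; apply/andP; split; lra.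
  split => //=; last by exists m; rewrite opprB addrC subrK.
  by move: up; rewrite !in_itv /= => /andP[u0 u1]; apply/andP; split; lra.
apply: eq_crossing => n; split; last exact: half.
by move/half; rewrite /reversed /=; case: g.
Qed.

(** Replacing a lift by a translate leaves the set of crossing parameters unchanged; only the index
    of the deck translation moves. The inverse translation gives the converse implication. *)
Lemma crossing_deck m g c : crossing R p q (deck_arc p q m g) c = crossing R p q g c.
Proof.
have half k g' n : crosses_in R p q g' c n -> crosses_in R p q (deck_arc p q k g') c n.
  move=> [f [f' [fr f'r fn]]]; exists (deck k \o f), f'; split => //.
    exact: represents_deck.
  rewrite (_ : crossings _ _ _ _ = crossings g' c f f') //.
  apply/seteqP; split=> -[u v] [/= up vp [l e]]; split => //=.
    by exists (l - k); apply: (@deck_inj k); rewrite deckD subrK.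
  by exists (l + k); rewrite e deckD.
apply: eq_crossing => n; split; last exact: half.
move/(half (- m)); rewrite (_ : deck_arc _ _ _ _ = g) //.
by case: g => -[a|a] [b|b]; rewrite /deck_arc /=; do !congr (_, _); congr (_ _); rewrite mulNr addrK.
Qed.

Lemma crossing_isotopic g h c : isotopic p q g h -> crossing R p q h c = crossing R p q g c.
Proof. by move=> [m [->|->]]; rewrite crossing_deck // crossing_reversed. Qed.

(** The shear is injective and commutes with deck translations, so applying it to both lifts
    preserves the crossing parameters. *)
Lemma crossing_twist m g h :
  crossing R p q (twist p m g) (twist p m h) = crossing R p q g h.
Proof.
have half k g' h' n : crosses_in R p q g' h' n -> crosses_in R p q (twist p k g') (twist p k h') n.
  move=> [f [f' [fr f'r fn]]]; exists (shear k \o f), (shear k \o f').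
  split; [exact: represents_twist|exact: represents_twist|].
  rewrite (_ : crossings _ _ _ _ = crossings g' h' f f') //.
  apply/seteqP; split=> -[u v] [/= up vp [l e]]; split => //=; exists l.
    by apply: (@shear_inj k); rewrite e shear_deck.
  by rewrite e shear_deck.
have twistK k : twist p (- k) (twist p k g) = g /\ twist p (- k) (twist p k h) = h.
  by case: g h => -[a|a] [b|b] [[a'|a'] [b'|b']]; rewrite /twist /= ?mulNr ?addrK.
apply: eq_crossing => n; split; last exact: half.
by move/(half (- m)); have [-> ->] := twistK m.
Qed.

Lemma crossingP c c' n :
  crosses_in R p q c c' n -> (forall n', crosses_in R p q c c' n' -> (n <= n')%N) ->
  crossing R p q c c' = n.
Proof.
move=> cn ncm; apply: xget_unique => // n' [cn' n'c].
by apply/eqP; rewrite eqn_leq n'c //= ncm.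
Qed.

End Invariance.

(** * Bridging arcs *)

(** * Sperner's lemma on a grid *)

Section FloorCeiling.
Implicit Types x y k : int.

Definition ceilz x (d : int) : int := - ((- x) %/ d)%Z.

Lemma ltz_ceilz x (d : int) k : 0 < d -> (k < ceilz x d) = (k * d < x).
Proof. by move=> d0; rewrite /ceilz ltrNr ltz_divLR // mulNr ltrN2. Qed.

Lemma divzMDr x (d : int) k : 0 < d -> ((x + k * d) %/ d)%Z = (x %/ d)%Z + k.
Proof. by move=> d0; rewrite addrC divzMDl ?gt_eqF // addrC. Qed.

Lemma ceilzMDr x (d : int) k : 0 < d -> ceilz (x + k * d) d = ceilz x d + k.
Proof.
by move=> d0; rewrite /ceilz opprD -mulNr divzMDr // opprD opprK.
Qed.

Lemma ceilz_le_divz x (d : int) : 0 < d -> (x %/ d)%Z <= ceilz x d <= (x %/ d)%Z + 1.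
Proof.
move=> d0; have xlt : x < ((x %/ d)%Z + 1) * d by rewrite -ltz_divLR // ltrDl.
apply/andP; split; last by rewrite leNgt ltz_ceilz // -leNgt ltW.
have : (- x < (- (x %/ d)%Z + 1) * d) by rewrite {1}(divz_eq x d); have := modz_ge0 x (lt0r_neq0 d0); lia.
by rewrite -ltz_divLR // /ceilz; lia.
Qed.

(* The number of integers lying strictly between x / d and y / e. *)
Definition gap x (d : int) y (e : int) : int :=
  Num.max 0 (Num.max (ceilz x d) (ceilz y e) - Num.min (x %/ d)%Z (y %/ e)%Z - 1).

(** The lower bound says that one of the two factors is negative, the upper bound that one is
    positive; together they say that the signs are opposite. *)
Lemma between_divz x (d : int) y (e : int) k : 0 < d -> 0 < e ->
  ((x - k * d) * (y - k * e) < 0) =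
  (Num.min (x %/ d)%Z (y %/ e)%Z < k < Num.max (ceilz x d) (ceilz y e)).
Proof.
move=> d0 e0; rewrite gt_min lt_max !ltz_divLR // !ltz_ceilz //.
rewrite -(subr_lt0 (k * d)) -(subr_gt0 (k * d)) -(subr_lt0 (k * e)) -(subr_gt0 (k * e)).
have [X0|X0|->] := ltgtP (x - k * d) 0; have [Y0|Y0|->] := ltgtP (y - k * e) 0;
  rewrite ?mulr0 ?mul0r ?ltxx //=.
- by apply/negbTE; rewrite -leNgt ltW // nmulr_rgt0.
- by rewrite nmulr_rlt0.
- by rewrite pmulr_rlt0.
- by apply/negbTE; rewrite -leNgt ltW // pmulr_rgt0.
Qed.

(** The ceiling and the floor of the same fraction differ by at most 1, so only the mixed pairs can
    contribute. In this form a shift of x by a multiple of d acts visibly. *)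
Lemma gapE x (d : int) y (e : int) : 0 < d -> 0 < e ->
  gap x d y e = Num.max 0 (Num.max (ceilz y e - (x %/ d)%Z - 1) (ceilz x d - (y %/ e)%Z - 1)).
Proof.
move=> d0 e0; have := ceilz_le_divz x d0; have := ceilz_le_divz y e0; rewrite /gap.
lia.
Qed.

End FloorCeiling.

(** * Explicit bridging arcs and the lower bound on their crossings *)

Section Bridging.
Variables (R : realType) (p q : nat) (p_gt0 : (0 < p)%N) (q_gt0 : (0 < q)%N).
Implicit Types (f : R -> R * R) (a b x y k : int) (kappa u v : R).

(** A straight segment bent sideways by a parabola of strength [kappa]. The height 1 - u makes it
    simple and forces two such arcs to meet at equal parameters. *)
Definition bow a b kappa u : R * R :=
  ((1 - u) * (a%:~R / p%:R) + u * (b%:~R / q%:R) + kappa * (u * (1 - u)), 1 - u).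

Lemma represents_bow a b kappa : represents p q (Arc (Outer a, Inner b)) (bow a b kappa).
Proof.
split.
- apply: continuous_subspaceT; apply: pair_continuous => u.
    have c1 : 1 - t @[t --> u] --> 1 - u by apply: cvgB; [exact: cvg_cst|exact: cvg_id].
    have c2 : (t : R) @[t --> u] --> u by exact: cvg_id.
    apply: cvgD; last by apply: cvgM; [exact: cvg_cst|exact: cvgM].
    by apply: cvgD; apply: cvgM => //; exact: cvg_cst.
  by apply: cvgB; [exact: cvg_cst|exact: cvg_id].
- by rewrite /bow /mpos /=; split; congr (_, _); ring.
- by move=> u; rewrite /= in_itv /= => /andP[u0 u1]; apply/andP; split; lra.
- by move=> u v m _ _ [_ /addrI/oppr_inj].
Qed.

Lemma card_le_inj_seq (T : Type) (A : set T) (n N : nat) (w : nat -> T) :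
  A #= `I_n -> (forall j, (j < N)%N -> A (w j)) ->
  (forall i j, (i < N)%N -> (j < N)%N -> w i = w j -> i = j) -> (N <= n)%N.
Proof.
move=> An Aw winj; rewrite -card_le_II.
have <- := card_le_eql (inj_card_eq (A := `I_N) (f := w) _).
  by rewrite -(card_le_eqr An); apply: subset_card_le => _ [j jN <-]; exact: Aw.
by move=> i j; rewrite !in_setE; exact: winj.
Qed.

(** Each integer k counted by the gap puts the endpoints of f and of the k-th translate of f' in
    opposite order, so they cross. Different k give different parameter pairs, since f u = deck k
    (f' v) determines k from (u, v). *)
Lemma gap_le_crossings a b a' b' n :
  crosses_in R p q (Arc (Outer a, Inner b)) (Arc (Outer a', Inner b')) n ->
  gap (a - a') p%:Z (b - b') q%:Z <= n%:Z.
Proof.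
have p0 : 0 < p%:Z by rewrite ltz_nat. have q0 : 0 < q%:Z by rewrite ltz_nat.
have pR : 0 < p%:R :> R by rewrite ltr0n. have qR : 0 < q%:R :> R by rewrite ltr0n.
move=> [f [f' [[fc [f0 f1] fi _] [f'c [f'0 f'1] f'i _] fn]]].
set N := gap _ _ _ _; pose lo := Num.min ((a - a') %/ p%:Z)%Z ((b - b') %/ q%:Z)%Z.
have cross k : ((a - a') - k * p%:Z) * ((b - b') - k * q%:Z) < 0 ->
    exists2 z, crossings (Arc (Outer a, Inner b)) (Arc (Outer a', Inner b')) f f' z
             & f z.1 = deck k (f' z.2).
  move=> opp; have [||||||||u [v [u01 v01 uv]]] :=
      opposite_paths_cross (f := f) (g := deck k \o f') (c0 := 0) (c1 := 1) fc.
  - by apply: within_comp f'c; exact: deck_continuous.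
  - by rewrite f0.
  - by rewrite /= f'0.
  - by rewrite f1.
  - by rewrite /= f'1.
  - by move=> u u01; apply: fi; rewrite /= in_itv.
  - by move=> u u01; apply: f'i; rewrite /= in_itv.
  - rewrite f0 f1 /= f'0 f'1 /=.
    have -> : (a%:~R / p%:R - (a'%:~R / p%:R + k%:~R)) * (b%:~R / q%:R - (b'%:~R / q%:R + k%:~R)) =
      (((a - a') - k * p%:Z) * ((b - b') - k * q%:Z))%:~R / (p%:R * q%:R) :> R.
      by rewrite !(intrM, intrD, intrN) -!pmulrn; field; rewrite !gt_eqF.
    by rewrite pmulr_llt0 ?ltrz0 // invr_gt0 mulr_gt0.
  exists (u, v) => //; split => /=; rewrite ?in_itv //; by exists k.
have inN j : (j < `|N|)%N -> (((a - a') - (lo + 1 + j%:Z) * p%:Z) *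
    ((b - b') - (lo + 1 + j%:Z) * q%:Z) < 0).
  by rewrite between_divz // /N /gap -/lo; lia.
have /choice[w wP] : forall j, exists z, (j < `|N|)%N ->
    crossings (Arc (Outer a, Inner b)) (Arc (Outer a', Inner b')) f f' z /\
    f z.1 = deck (lo + 1 + j%:Z) (f' z.2).
  move=> j; have [/inN/cross[z z1 z2]|] := boolP (j < `|N|)%N; last by exists (0, 0).
  by exists z.
suff : (`|N| <= n)%N by rewrite /N /gap; lia.
apply: (card_le_inj_seq (w := w) fn) => [j /wP[]//|i j iN jN wij].
have [_ e1] := wP i iN; have [_ e2] := wP j jN.
have := congr1 fst (etrans (esym e1) (etrans (congr1 (f \o fst) wij) e2)).
rewrite /= wij => /addrI/intr_inj; lia.
Qed.

End Bridging.

(** * Sperner's lemma on a grid *)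

Section CrossingNumbers.
Variables (R : realType) (p q : nat) (p_gt0 : (0 < p)%N) (q_gt0 : (0 < q)%N).
Implicit Types (f : R -> R * R) (a b x y k : int) (kappa u v : R).

(** A straight segment meets a translate of another one at most once, and exactly when their offsets
    at the two ends have opposite signs. The hypothesis excludes a translate that coincides with the
    segment. *)
Lemma bow_crossings_gap a b a' b' :
  ~ (exists k, a - a' = k * p%:Z /\ b - b' = k * q%:Z) ->
  crossings (Arc (Outer a, Inner b)) (Arc (Outer a', Inner b'))
    (@bow R p q a b 0) (@bow R p q a' b' 0) #= `I_(`|gap (a - a') p%:Z (b - b') q%:Z|).
Proof.
have p0 : 0 < p%:Z by rewrite ltz_nat. have q0 : 0 < q%:Z by rewrite ltz_nat.
have pR : 0 < p%:R :> R by rewrite ltr0n. have qR : 0 < q%:R :> R by rewrite ltr0n.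
move=> nondeg; set N := gap _ _ _ _.
pose lo := Num.min ((a - a') %/ p%:Z)%Z ((b - b') %/ q%:Z)%Z.
(* [X k] and [Y k] are the horizontal offsets from the k-th translate at the outer and the inner
   end; in between the offset is interpolated linearly. *)
pose X k : R := ((a - a') - k * p%:Z)%:~R / p%:R.
pose Y k : R := ((b - b') - k * q%:Z)%:~R / q%:R.
have XE k : X k = a%:~R / p%:R - a'%:~R / p%:R - k%:~R.
  by rewrite /X !(intrM, intrD, intrN) -!pmulrn; field; rewrite gt_eqF.
have YE k : Y k = b%:~R / q%:R - b'%:~R / q%:R - k%:~R.
  by rewrite /Y !(intrM, intrD, intrN) -!pmulrn; field; rewrite gt_eqF.
have XY k : (X k * Y k < 0) = (((a - a') - k * p%:Z) * ((b - b') - k * q%:Z) < 0).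
  rewrite /X /Y mulrACA -invfM -intrM pmulr_llt0 ?ltrz0 // invr_gt0 mulr_gt0 //.
have X_eq0 k : X k = 0 -> a - a' = k * p%:Z.
  by move/eqP; rewrite mulf_eq0 invr_eq0 intr_eq0 (gt_eqF pR) orbF subr_eq0 => /eqP.
have Y_eq0 k : Y k = 0 -> b - b' = k * q%:Z.
  by move/eqP; rewrite mulf_eq0 invr_eq0 intr_eq0 (gt_eqF qR) orbF subr_eq0 => /eqP.
clearbody X Y.
have on_deck k u : @bow R p q a b 0 u = deck k (bow p q a' b' 0 u) <-> (1 - u) * X k + u * Y k = 0.
  rewrite XE YE /deck /bow /=; split=> [[e]|e].
    by apply/eqP; rewrite -subr_eq0 in e *; apply/eqP; lra.
  by congr (_, _); apply/eqP; rewrite -subr_eq0; apply/eqP; rewrite -[RHS]e; ring.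
pose w k : R := X k / (X k - Y k).
pose W (j : nat) : R * R := (w (lo + 1 + j%:Z), w (lo + 1 + j%:Z)).
have wP k : X k * Y k < 0 -> 0 < w k < 1 /\ (1 - w k) * X k + w k * Y k = 0.
  move=> opp; have XY0 : X k - Y k != 0.
    by apply: contraTneq opp => /eqP; rewrite subr_eq0 => /eqP ->; rewrite -leNgt -expr2 sqr_ge0.
  split; last by rewrite /w; field.
  have [X0|X0|X0] := ltgtP (X k) 0; last by move: opp; rewrite X0 mul0r ltxx.
    have Y0 : 0 < Y k by rewrite -(nmulr_rlt0 _ X0).
    have D0 : X k - Y k < 0 by lra.
    by rewrite /w ltr_ndivlMr // ltr_ndivrMr // mul0r mul1r; apply/andP; split; lra.
  have Y0 : Y k < 0 by rewrite -(pmulr_rlt0 _ X0).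
  have D0 : 0 < X k - Y k by lra.
  by rewrite /w ltr_pdivlMr // ltr_pdivrMr // mul0r mul1r; apply/andP; split; lra.
have inN j : (j < `|N|)%N -> X (lo + 1 + j%:Z) * Y (lo + 1 + j%:Z) < 0.
  by rewrite XY between_divz // /N /gap -/lo; lia.
rewrite (_ : crossings _ _ _ _ = W @` `I_`|N|).
  apply: inj_card_eq => i j; rewrite !in_setE /= => iN jN [wij _].
  have [_ /on_deck e1] := wP _ (inN i iN); have [_ /on_deck] := wP _ (inN j jN).
  rewrite -wij e1 => /(congr1 fst) /= /addrI/intr_inj; lia.
apply/seteqP; split=> [[u v] [/= u01 v01 [k e]]|_ [j jN <-]]; last first.
  have [w01 /on_deck we] := wP _ (inN j jN).
  by split => /=; rewrite ?in_itv //; exists (lo + 1 + j%:Z).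
move: u01 v01; rewrite !in_itv /= => /andP[u0 u1] _.
have uv : u = v by case: e => _ /addrI/oppr_inj.
move: e; rewrite -uv => /on_deck e.
have opp : X k * Y k < 0.
  have [X0|X0|X0] := ltgtP (X k) 0.
  - by rewrite nmulr_rlt0 // -(pmulr_rgt0 _ u0); have : (1 - u) * X k < 0 by [rewrite pmulr_rlt0 //; lra]; lra.
  - by rewrite pmulr_rlt0 // -(pmulr_rlt0 _ u0); have : 0 < (1 - u) * X k by [rewrite pmulr_rgt0 //; lra]; lra.
  - case: nondeg; exists k; split; first exact: X_eq0.
    by apply: Y_eq0; move: e; rewrite X0 mulr0 add0r => /eqP; rewrite mulf_eq0 gt_eqF // => /eqP.
exists `|(k - lo - 1)%R|%N.
  by move: opp; rewrite XY between_divz //= /N /gap -/lo; lia.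
rewrite /W; suff -> : w (lo + 1 + `|(k - lo - 1)%R|%N%:Z) = u by [].
have -> : lo + 1 + `|(k - lo - 1)%R|%N%:Z = k.
  by move: opp; rewrite XY between_divz //= -/lo; lia.
have XY0 : X k - Y k != 0.
  by apply: contraTneq opp => /eqP; rewrite subr_eq0 => /eqP ->; rewrite -leNgt -expr2 sqr_ge0.
by apply: (mulIf XY0); rewrite /w divfK //; lra.
Qed.

(* Isotopic bridging arcs have a common straight representative, so one of them
   is bowed away from it, by less than a full turn. *)
Lemma bow_crossings0 a b a' b' k : a - a' = k * p%:Z -> b - b' = k * q%:Z ->
  crossings (Arc (Outer a, Inner b)) (Arc (Outer a', Inner b'))
    (@bow R p q a b 0) (@bow R p q a' b' 1) = set0.
Proof.
have pR : p%:R != 0 :> R by rewrite pnatr_eq0 -lt0n.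
have qR : q%:R != 0 :> R by rewrite pnatr_eq0 -lt0n.
move=> /eqP; rewrite subr_eq addrC => /eqP aE /eqP; rewrite subr_eq addrC => /eqP bE.
apply/seteqP; split=> // -[u v] [/= + _ [m [e /addrI/oppr_inj uv]]].
rewrite in_itv /= => /andP[u0 u1]; move: e; rewrite -uv aE bE !intrD !intrM -!pmulrn.
rewrite !mulrDl !mulfK // => e.
(* A crossing would equate an integer with a number strictly between 0 and 1. *)
have {}e : (k - m)%:~R = u * (1 - u) by rewrite intrD intrN; lra.
have : 0 < ((k - m)%:~R : R) < 1 by rewrite e; apply/andP; split; nra.
by rewrite ltr0z ltrz1; lia.
Qed.

Lemma crossing_bridging a b a' b' :
  (crossing R p q (Arc (Outer a, Inner b)) (Arc (Outer a', Inner b')))%:Z =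
  gap (a - a') p%:Z (b - b') q%:Z.
Proof.
have p0 : 0 < p%:Z by rewrite ltz_nat. have q0 : 0 < q%:Z by rewrite ltz_nat.
rewrite (@crossingP R p q _ _ `|gap (a - a') p%:Z (b - b') q%:Z|).
- by rewrite /gap; lia.
(* For isotopic arcs both fractions equal k, so the gap is 0, and the bowed copy realises it. *)
- have [[k [aE bE]]|nondeg] := pselect (exists k, a - a' = k * p%:Z /\ b - b' = k * q%:Z).
    exists (bow p q a b 0), (bow p q a' b' 1); split; [exact: represents_bow..|].
    rewrite (bow_crossings0 aE bE) aE bE gapE // /ceilz -!mulNr !mulzK ?gt_eqF // opprK subrr.
    by apply/card_esym; rewrite (_ : absz _ = 0%N) ?II0 ?card_eq00 //; lia.
  exists (bow p q a b 0), (bow p q a' b' 0); split; [exact: represents_bow..|].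
  exact: bow_crossings_gap.
- by move=> n /gap_le_crossings; rewrite /gap; lia.
Qed.

Lemma represents_core (c : R) : 0 < c < 1 -> represents p q Core (fun u => (u, c)).
Proof.
move=> c01; split=> //.
- apply: continuous_subspaceT; apply: pair_continuous => u; [exact: cvg_id|exact: cvg_cst].
- by rewrite /deck /= add0r.
- move=> u v m; rewrite /= !in_itv /= => /andP[u0 u1] /andP[v0 v1] [e].
  have : -1 < (m%:~R : R) < 1 by apply/andP; split; lra.
  rewrite ltrz1 -[-1 : R]/((-1)%:~R) ltr_int => m0.
  have {}m0 : m = 0 by lia.
  by rewrite e m0 addr0.
Qed.

Lemma crossing_bridging_core a b :
  crossing R p q (Arc (Outer a, Inner b)) Core = 1%N.
Proof.
apply: crossingP.
  exists (bow p q a b 0), (fun u => (u, 1 / 2)); split; first exact: represents_bow.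
    by apply: represents_core; lra.
  pose x : R := (bow p q a b 0 (1 / 2)).1.
  (* The heights force u = 1 / 2; the core parameter, being in [0, 1), is the fractional part of the
     abscissa x. *)
  rewrite (_ : crossings _ _ _ _ = [set (1 / 2, x - (Num.floor x)%:~R)]); first exact: card_set1.
  have /andP[x1 x2] := floor_itv x.
  apply/seteqP; split=> [[u v]|_ ->].
    rewrite /crossings /= !in_itv /= => -[/andP[u0 u1] /andP[v0 v1] [m [e1 e2]]].
    have uE : u = 1 / 2 by lra.
    rewrite uE; congr (_, _); have xE : x = v + m%:~R by rewrite -e1 uE.
    suff -> : Num.floor x = m by rewrite xE; ring.
    by apply: floor_def; rewrite intrD xE; apply/andP; split; lra.
  split => /=; rewrite ?in_itv /=; [lra|by rewrite intrD in x2; apply/andP; split; lra|].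
  exists (Num.floor x); rewrite /deck /= subrK /x /bow /=; congr (_, _); lra.
move=> n [f [h [[fc [f0 f1] fi _] [hc h1 hi _] hn]]].
have {}hi v : 0 <= v <= 1 -> 0 < (h v).2 < 1.
  have h0 : 0 < (h 0).2 < 1 by apply: hi; rewrite /= in_itv /= lexx ltr01.
  move=> /unit_itvP[->//|->|/andP[v0 v1]]; first by rewrite h1.
  by apply: hi; rewrite /= in_itv /= v1 ltW.
have [u [v [k [u01 v01 uv]]]] := essential_loop_cross fc hc (congr1 snd f0) (congr1 snd f1) h1 hi.
apply: (card_le_inj_seq (w := fun=> (u, v)) hn) => [j _|[|i] [|j]] //.
by split; rewrite /= ?in_itv //; exists k.
Qed.

Lemma crossing_core0 g f (c : R) : represents p q (Arc g) f -> 0 < c < 1 ->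
  (forall u, 0 < u < 1 -> (f u).2 != c) -> crossing R p q (Arc g) Core = 0%N.
Proof.
move=> fr c01 fc; apply: crossingP => //.
exists f, (fun u => (u, c)); split=> //; first exact: represents_core.
rewrite (_ : crossings _ _ _ _ = set0); first by apply/card_esym; rewrite II0 card_eq00.
apply/seteqP; split=> // -[u v] [/= + _ [m e]]; rewrite in_itv /= => /fc /eqP; apply.
by rewrite e.
Qed.

(** The height of an arc attached to the outer boundary has a positive minimum, and the horizontal
    core at half that height misses it. For the inner boundary the maximum is used in the same
    way. *)
Lemma crossing_peripheral_core g f : represents p q (Arc g) f -> peripheral g ->
  crossing R p q (Arc g) Core = 0%N.
Proof.
move=> fr gper; have [fc f01 fi _] := fr.
have f2c : {within `[0, 1], continuous (fun u => (f u).2)}.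
  by apply: (@within_comp _ _ snd f) fc => z; exact: cvg_snd.
case: g gper fr f01 {fi} (fi : forall u, _ -> _) => -[a|a] [b|b] //= _ fr [f0 f1] fi.
  have [c c01 cmin] := EVT_min ler01 f2c.
  have c0 : 0 < (f c).2.
    move: c01; rewrite in_itv => /unit_itvP[->|->|c01]; rewrite ?f0 ?f1 //.
    by have /andP[] := fi c c01.
  have c1 : (f c).2 <= 1.
    by have := cmin 0; rewrite f0; apply; rewrite in_itv /= lexx ler01.
  apply: (@crossing_core0 _ f ((f c).2 / 2)) => //; first by lra.
  move=> u /andP[u0 u1]; have /cmin h : u \in `[0, 1] by rewrite in_itv /= !ltW.
  by apply/eqP => e; clear f0 f1; lra.
have [c c01 cmax] := EVT_max ler01 f2c.
have c0 : (f c).2 < 1.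
  move: c01; rewrite in_itv => /unit_itvP[->|->|c01]; rewrite ?f0 ?f1 //.
  by have /andP[] := fi c c01.
have c1 : 0 <= (f c).2.
  by have := cmax 0; rewrite f0; apply; rewrite in_itv /= lexx ler01.
apply: (@crossing_core0 _ f (((f c).2 + 1) / 2)) => //; first by lra.
move=> u /andP[u0 u1]; have /cmax h : u \in `[0, 1] by rewrite in_itv /= !ltW.
  by apply/eqP => e; clear f0 f1; lra.
Qed.

End CrossingNumbers.

(** * Peripheral arcs *)

(** * Sperner's lemma on a grid *)

Section Peripheral.
Variables (R : realType) (p q : nat) (p_gt0 : (0 < p)%N) (q_gt0 : (0 < q)%N).
Implicit Types (f : R -> R * R) (g : ann_arc) (a b m : int).

(** If the endpoints were more than 1 apart, those of f and of its translate by 1 would interleave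
    and the two would cross. Simplicity then makes the parameters equal, so a point would equal its
    own translate. *)
Lemma simple_excursion_le1 f (c : R) : {within `[0, 1], continuous f} ->
  (f 0).2 = c -> (f 1).2 = c -> (forall u, 0 < u < 1 -> (f u).2 < c) ->
  (forall u v m, 0 < u < 1 -> 0 < v < 1 -> f u = deck m (f v) -> u = v) ->
  `|(f 0).1 - (f 1).1| <= 1.
Proof.
wlog le01 : f / (f 0).1 <= (f 1).1.
  move=> hw fc f0 f1 fi fs; have [le01|le10] := leP (f 0).1 (f 1).1; first exact: hw.
  have flip (u : R) : 0 < u < 1 -> 0 < 1 - u < 1.
    by move=> /andP[u0 u1]; apply/andP; split; lra.
  rewrite distrC; have := hw (fun u => f (1 - u)); rewrite subr0 subrr; apply => //.
  - exact: ltW.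
  - exact: within_comp_onem.
  - by move=> u /flip; exact: fi.
  - by move=> u v m /flip u01 /flip v01 /fs -/(_ u01 v01); lra.
move=> fc f0 f1 fi fs; rewrite distrC ger0_norm ?subr_ge0 // leNgt; apply/negP => gt1.
have [||||||||u [v [u01 v01 uv]]] :=
    interleaved_paths_cross (f := f) (g := deck 1 \o f) fc _ f0 f1.
- by apply: within_comp fc; exact: deck_continuous.
- by rewrite /= f0.
- by rewrite /= f1.
- exact: fi.
- by move=> v /fi.
- by rewrite /=; lra.
- by rewrite /=; lra.
- by rewrite /=; lra.
have uvE := fs _ _ _ u01 v01 uv.
by have := congr1 fst uv; rewrite uvE /=; lra.
Qed.

Definition same_side_le g : bool :=
  match g with
  | (Outer a, Outer b) => `|a - b| <= p%:Z
  | (Inner a, Inner b) => `|a - b| <= q%:Z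
  | _ => false
  end.

Lemma peripheral_same_side_le g f : represents p q (Arc g) f -> peripheral g -> same_side_le g.
Proof.
have scale (d : nat) a b : (0 < d)%N -> `|a%:~R / d%:R - b%:~R / d%:R : R| <= 1 -> `|a - b| <= d%:Z.
  move=> d0; have dR : 0 < d%:R :> R by rewrite ltr0n.
  rewrite -mulrBl normrM [`|_^-1|]gtr0_norm ?invr_gt0 // ler_pdivrMr // mul1r.
  by rewrite -intrB -intr_norm [d%:R]pmulrn ler_int.
case: g => -[a|a] [b|b] // [fc [f0 f1] fi fs] _ /=.
  apply: scale => //; have := @simple_excursion_le1 f 1 fc; rewrite f0 f1; apply => //.
    by move=> u u01; move: (fi u); rewrite /= in_itv => /(_ u01)/andP[].
(* Reflection in the horizontal axis turns an arc above the inner boundary into a path below height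
   0. *)
apply: scale => //; pose phi (z : R * R) := (z.1, - z.2).
have phic : continuous phi.
  by apply: pair_continuous => z; [exact: cvg_fst|apply: cvgN; exact: cvg_snd].
have := @simple_excursion_le1 (phi \o f) 0 (within_comp phic fc); rewrite /= f0 f1; apply.
- by rewrite /= oppr0.
- by rewrite /= oppr0.
- by move=> u u01; move: (fi u); rewrite /= in_itv oppr_lt0 => /(_ u01)/andP[].
- move=> u v m u01 v01 [e1 /oppr_inj e2]; apply: (fs _ _ m); rewrite /= ?in_itv //.
  by rewrite (surjective_pairing (f u)) e1 e2.
Qed.

(** A finite list of arcs meeting every class with endpoints at most one turn apart: with d points
    on the boundary, the first endpoint is reduced into [0, d) and the second then lies in
    [-d, 2 d], stored with offset d. *)
Definition short_arc (w : 'I_p * 'I_(3 * p).+1 + 'I_q * 'I_(3 * q).+1) : ann_arc :=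
  match w with
  | inl (x, y) => (Outer (x : nat)%:Z, Outer ((y : nat)%:Z - p%:Z))
  | inr (x, y) => (Inner (x : nat)%:Z, Inner ((y : nat)%:Z - q%:Z))
  end.

Lemma short_translate (d : nat) a b : (0 < d)%N -> `|a - b| <= d%:Z ->
  exists (x : 'I_d) (y : 'I_(3 * d).+1) m,
    a = (x : nat)%:Z + m * d%:Z /\ b = (y : nat)%:Z - d%:Z + m * d%:Z.
Proof.
move=> d0 ab; have dZ : 0 < d%:Z by rewrite ltz_nat.
have r0 := modz_ge0 a (lt0r_neq0 dZ); have r1 := ltz_pmod a dZ; have aE := divz_eq a d%:Z.
pose y := b + d%:Z - (a %/ d%:Z)%Z * d%:Z.
have xlt : (`|(a %% d%:Z)%Z| < d)%N by lia.
have ylt : (`|y| < (3 * d).+1)%N by rewrite /y; lia.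
exists (Ordinal xlt), (Ordinal ylt), (a %/ d%:Z)%Z => /=.
by split; rewrite ?/y; lia.
Qed.

Lemma short_arc_isotopic g : same_side_le g -> exists w, isotopic p q (short_arc w) g.
Proof.
case: g => -[a|a] [b|b] //=.
  move=> /(short_translate p_gt0)[x [y [m [-> ->]]]].
  by exists (inl (x, y)), m; left.
move=> /(short_translate q_gt0)[x [y [m [-> ->]]]].
by exists (inr (x, y)), m; left.
Qed.

(** On two outer endpoints the twist is the deck translation by 1; on two inner endpoints it is the
    identity. *)
Lemma twist_peripheral g : peripheral g -> isotopic p q (twist p 1 g) g.
Proof.
case: g => -[a|a] [b|b] //= _.
  by exists (-1); left; rewrite /deck_arc /twist /= !mul1r !mulN1r !addrK.
by exists 0; left; rewrite /deck_arc /twist /= !mul0r !addr0.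
Qed.

End Peripheral.

(** * Crossing vectors of the fan triangulation *)

Section Fan.
Variables (R : realType) (p q : nat) (p_gt0 : (0 < p)%N) (q_gt0 : (0 < q)%N).
Variables (s t : 'I_(p + q)).
Hypotheses (hs : fan s = (Outer 0, Inner 0)) (ht : fan t = (Outer p%:Z, Inner 0)).
Implicit Types (f : R -> R * R) (g : ann_arc) (a b m : int).

Lemma source_index : (s : nat) = 0%N.
Proof. by move: hs; rewrite /fan; case: leqP => _ [] //; lia. Qed.

Lemma sink_index : (t : nat) = p.
Proof. by move: ht; rewrite /fan; case: leqP => + [] => + e; lia. Qed.

(** Vertices and arrows have the same indices, so the defect is a sum of differences between x at i
    and at the target of arrow i. These vanish for i at least p, and the others telescope from the
    source to the sink. *)
Lemma defect_fan (x : 'cV[int]_(p + q)) : defect (fan_quiver p q) x = x s 0 - x t 0.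
Proof.
pose X k := if insub k is Some i then x i 0 else 0.
have XE (i : 'I_(p + q)) : X i = x i 0 by rewrite /X valK.
rewrite /defect /euler -(XE s) -(XE t) source_index sink_index.
under eq_bigr do rewrite mxE mul1r.
under [X in _ - X]eq_bigr do rewrite mxE mul1r.
rewrite -sumrB.
have step (i : 'I_(p + q)) : x i 0 - x (@tgt _ (fan_quiver p q) i) 0 =
    X i - X (if (i < p)%N then i.+1 else i).
  rewrite -!XE /=; case: ltnP => // ip; congr (_ - X _).
  by rewrite /= modn_small //; lia.
rewrite (eq_bigr _ (fun i _ => step i)).
rewrite -(big_mkord xpredT (fun i => X i - X (if (i < p)%N then i.+1 else i))).
rewrite (big_cat_nat (n := p)) ?leq_addr //=.
rewrite [X in _ + X]big_nat_cond [X in _ + X]big1 ?addr0; last first.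
  by move=> i /andP[/andP[pi _] _]; rewrite ltnNge pi subrr.
under eq_big_nat => i /andP[_ ip] do rewrite ip -opprB.
by rewrite sumrN telescope_sumr // opprB.
Qed.

Lemma fan_outer_inner i : exists a b, [/\ @fan p q i = (Outer a, Inner b), 0 <= a <= p%:Z,
  0 <= b < q%:Z & a = p%:Z \/ b = 0].
Proof.
rewrite /fan; case: leqP => ip; have := ltn_ord i.
  by exists (i : nat)%:Z, 0; split; [by []|lia|lia|by right].
by exists p%:Z, (i - p)%N%:Z; split; [by []|lia|lia|by left].
Qed.

Lemma fan_surj a b : 0 <= a <= p%:Z -> 0 <= b < q%:Z -> a = p%:Z \/ b = 0 ->
  exists i, @fan p q i = (Outer a, Inner b).
Proof.
move=> a0 b0 ab; have [b0'|bn0] := eqVneq b 0.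
  have lt : (`|a| < p + q)%N by lia.
  exists (Ordinal lt); rewrite /fan /= b0' (_ : (`|a| <= p)%N) //; last by lia.
  by congr (Outer _, _); lia.
have lt : (p + `|b| < p + q)%N by lia.
exists (Ordinal lt); rewrite /fan /= (_ : (p + `|b| <= p)%N = false); last by lia.
by congr (Outer _, Inner _); lia.
Qed.

Lemma isotopic_reversed g h : isotopic p q g h -> isotopic p q g (reversed h).
Proof. by move=> [m [->|->]]; exists m; [right|left]. Qed.

Lemma crossv_reversed g : crossv R p q (reversed g) = crossv R p q g.
Proof. by apply/matrixP => i j; rewrite !mxE crossing_reversed. Qed.

Lemma divz_ceilz_unit (d x : int) : 0 < d -> 0 <= x <= d ->
  [/\ 0 <= (x %/ d)%Z <= 1, 0 <= ceilz x d <= 1, x = 0 -> (x %/ d)%Z = 0 /\ ceilz x d = 0 &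
      x = d -> (x %/ d)%Z = 1 /\ ceilz x d = 1].
Proof.
move=> d0 /andP[x0 xd].
have f0 : 0 <= (x %/ d)%Z by rewrite lez_divRL // mul0r.
have f1 : ceilz x d <= 1 by rewrite leNgt ltz_ceilz // mul1r -leNgt.
have /andP[c1 c2] := ceilz_le_divz x d0.
split; [lia|lia| |]; move=> xE.
  by have : ~~ (0 < ceilz x d) by [rewrite ltz_ceilz // mul0r xE ltxx]; lia.
by have : 1 <= (x %/ d)%Z by [rewrite lez_divRL // mul1r xE]; lia.
Qed.

(** Used in contrapositive form, to certify that a twist of a bridging arc lies outside the
    triangulation. *)
Lemma crossv_in_fan g : in_fan p q g -> crossv R p q g s 0 = 0 /\ crossv R p q g t 0 = 0.
Proof.
have p0 : 0 < p%:Z by rewrite ltz_nat. have q0 : 0 < q%:Z by rewrite ltz_nat.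
move=> [i ig]; rewrite !mxE !(crossing_isotopic R p_gt0 q_gt0 _ ig) hs ht.
have [a [b [-> a01 b01 ab]]] := fan_outer_inner i.
rewrite !crossing_bridging // !gapE // !subr0 -[- p%:Z]mulN1r divzMDr // ceilzMDr //.
have [a1 a2 _ a3] := divz_ceilz_unit p0 a01.
have [|b1 b2 b3 _] := @divz_ceilz_unit q%:Z b q0; first by lia.
by case: ab => [/a3|/b3] []; lia.
Qed.

(** By [gapE], m twists shift the floor and ceiling of the outer fraction by m, which produces a V
    with flat bottom from P i to Q i. Passing from [fan s] to [fan t] shifts that fraction by one
    turn, hence P and Q by 1; the range in the last clause is where both coordinates vanish. *)
Lemma bridging_orbit g : bridging g -> exists P Q : 'I_(p + q) -> int,
  [/\ forall i, P i <= Q i,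
      forall m i, crossv R p q (twist p m g) i 0 = Num.max 0 (Num.max (P i - m) (m - Q i)),
      P t = P s + 1 /\ Q t = Q s + 1 &
      forall m, P s < m <= Q s -> in_fan p q (twist p m g)].
Proof.
have p0 : 0 < p%:Z by rewrite ltz_nat. have q0 : 0 < q%:Z by rewrite ltz_nat.
wlog [a [b ->]] : g / exists a b, g = (Outer a, Inner b).
  move=> hw; case: g => -[a|a] [b|b] //= _; first by apply: hw => //; exists a, b.
  have [|//|P [Q [PQ dE PQt fanE]]] := hw (Outer b, Inner a); first by exists b, a.
  exists P, Q; split => // [m i|m /fanE[i]].
    by rewrite -dE -crossv_reversed.
  by move=> /isotopic_reversed; exists i.
move=> _; pose x i := if fst (@fan p q i) is Outer c then c else 0.
pose y i := if snd (@fan p q i) is Inner c then c else 0.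
have fanE i : @fan p q i = (Outer (x i), Inner (y i)).
  by rewrite /x /y; have [c [d [-> _ _ _]]] := fan_outer_inner i.
exists (fun i => ceilz (b - y i) q%:Z - ((a - x i) %/ p%:Z)%Z - 1).
exists (fun i => ((b - y i) %/ q%:Z)%Z - ceilz (a - x i) p%:Z + 1).
have xs : x s = 0 by rewrite /x hs. have ys : y s = 0 by rewrite /y hs.
have xt : x t = p%:Z by rewrite /x ht. have yt : y t = 0 by rewrite /y ht.
split.
- move=> i; have := ceilz_le_divz (a - x i) p0; have := ceilz_le_divz (b - y i) q0; lia.
- move=> m i; rewrite mxE fanE crossing_bridging // gapE // [a + _ - _]addrAC.
  rewrite divzMDr // ceilzMDr //; congr (Num.max 0 (Num.max _ _)) => /=; ring.
- rewrite xs ys xt yt !subr0 -[- p%:Z]mulN1r divzMDr // ceilzMDr //; lia.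
move=> m; rewrite xs ys !subr0 => mPQ.
have aE := divz_eq a p%:Z; have bE := divz_eq b q%:Z.
have a0 := modz_ge0 a (lt0r_neq0 p0); have b0 := modz_ge0 b (lt0r_neq0 q0).
have a1 := ltz_pmod a p0; have b1 := ltz_pmod b q0.
have ca := ceilz_le_divz a p0; have cb := ceilz_le_divz b q0.
have ca0 : ((a %/ p%:Z)%Z < ceilz a p%:Z) = (0 < (a %% p%:Z)%Z).
  by rewrite ltz_ceilz // {2}aE ltrDl.
have cb0 : ((b %/ q%:Z)%Z < ceilz b q%:Z) = (0 < (b %% q%:Z)%Z).
  by rewrite ltz_ceilz // {2}bE ltrDl.
(* The outer endpoint of the lift whose inner endpoint is b modulo q. The range of m leaves only a
   modulo p, with b divisible by q, or p, with a divisible by p. *)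
pose c := a + (m - (b %/ q%:Z)%Z) * p%:Z.
have cP : 0 <= c <= p%:Z /\ (c = p%:Z \/ (b %% q%:Z)%Z = 0).
  have [e0|e1] : (a %/ p%:Z)%Z + m - (b %/ q%:Z)%Z = 0 \/ (a %/ p%:Z)%Z + m - (b %/ q%:Z)%Z = 1 by lia.
    have -> : c = (a %% p%:Z)%Z.
      by rewrite /c {1}aE -[RHS]addr0 -(mul0r p%:Z) -e0; ring.
    by split; [lia|right; lia].
  have -> : c = (a %% p%:Z)%Z + p%:Z.
    by rewrite /c {1}aE -[X in _ = _ + X]mul1r -e1; ring.
  by split; [lia|left; lia].
have [//|||i iE] := @fan_surj c (b %% q%:Z)%Z; [by case: cP|lia|by case: cP|].
exists i, (b %/ q%:Z)%Z; left; rewrite iE /deck_arc /twist /= /c {1}bE.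
by congr (Outer _, Inner _); ring.
Qed.

Lemma twist0 g : twist p 0 g = g.
Proof. by case: g => -[a|a] [b|b]; rewrite /twist /= ?mul0r ?addr0. Qed.

(* The twist fixes g and carries fan s to fan t. *)
Lemma crossv_peripheral g : peripheral g -> crossv R p q g s 0 = crossv R p q g t 0.
Proof.
move=> gper; rewrite !mxE -(crossing_twist R q p_gt0 1 g (fan s)).
rewrite (_ : twist p 1 (fan s) = fan t); last by rewrite hs ht /twist /= mul1r add0r.
by rewrite -(crossing_isotopic R p_gt0 q_gt0 _ (twist_peripheral p q gper)).
Qed.

Lemma crossing_bridging_core_eq1 g : bridging g -> crossing R p q g Core = 1%N.
Proof.
case: g => -[a|a] [b|b] //= _; first exact: crossing_bridging_core.
by rewrite -crossing_reversed // crossing_bridging_core.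
Qed.

Lemma bridging_essential g : bridging g -> essential R p q g.
Proof.
case: g => -[a|a] [b|b] //= _; split => //; first by exists (bow p q a b 0); exact: represents_bow.
by eexists; exact: (represents_reversed (represents_bow p q b a 0)).
Qed.

(** For a bridging arc the coordinates at s and t are values of one V, displaced by one twist. They
    differ by 1 except on the flat range, where the arc belongs to the triangulation. *)
Lemma essential_dichotomy g : essential R p q g -> ~ in_fan p q g ->
  let e := crossv R p q g s 0 - crossv R p q g t 0 in
  [/\ bridging g, crossing R p q g Core = 1%N & e = 1 \/ e = -1] \/
  [/\ peripheral g, crossing R p q g Core = 0%N & e = 0].
Proof.
move=> [[f fr] _] gfan; have [gb|gp] := boolP (bridging g); [left|right]; split => //.
- exact: crossing_bridging_core_eq1.
- have [P [Q [PQ dE [Pt Qt] fanE]]] := bridging_orbit gb.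
  have := dE 0 s; have := dE 0 t; rewrite twist0 => -> ->.
  have : ~ (P s < 0 <= Q s) by move=> /fanE; rewrite twist0.
  by have := PQ s; lia.
- exact: crossing_peripheral_core fr gp.
- by rewrite crossv_peripheral // subrr.
Qed.

Lemma bridging_arms g : bridging g ->
  exists m0 m1 : int, m0 <= m1 /\
    [/\ (forall m, m0 <= m < m1 -> in_fan p q (twist p m g)),
        (forall m, m1 <= m ->
           [/\ ~ in_fan p q (twist p m g), line 1 (pi_st s t (crossv R p q (twist p m g))) &
               pi_st s t (crossv R p q (twist p (m + 1) g)) =
               pi_st s t (crossv R p q (twist p m g) + delta)]),
        (forall m, m < m0 ->
           [/\ ~ in_fan p q (twist p m g), line (-1) (pi_st s t (crossv R p q (twist p m g))) &
               pi_st s t (crossv R p q (twist p (m - 1) g)) =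
               pi_st s t (crossv R p q (twist p m g) + delta)]),
        (forall z : int * int, line 1 z -> 0 <= z.1 -> 0 <= z.2 ->
           exists2 m, m1 <= m & pi_st s t (crossv R p q (twist p m g)) = z) &
        (forall z : int * int, line (-1) z -> 0 <= z.1 -> 0 <= z.2 ->
           exists2 m, m < m0 & pi_st s t (crossv R p q (twist p m g)) = z)].
Proof.
move=> gb; have [P [Q [PQ dE [Pt Qt] fanE]]] := bridging_orbit gb.
(* The flat range P s < m <= Q s, written as m0 <= m < m1; it may be empty. *)
have PQs := PQ s; exists (P s + 1), (Q s + 1); split; first by lia.
have nofan m : ~~ (P s < m <= Q s) -> ~ in_fan p q (twist p m g).
  by move=> mPQ /crossv_in_fan; rewrite !dE; lia.
split.
- by move=> m mPQ; apply: fanE; lia.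
- move=> m mQ; split; first by apply: nofan; lia.
    by rewrite /line /pi_st /= !dE; lia.
  by rewrite /pi_st ![((_ : 'cV_(p + q)) + _) _ _]mxE [delta s 0]mxE [delta t 0]mxE !dE; congr (_, _); lia.
- move=> m mP; split; first by apply: nofan; lia.
    by rewrite /line /pi_st /= !dE; lia.
  by rewrite /pi_st ![((_ : 'cV_(p + q)) + _) _ _]mxE [delta s 0]mxE [delta t 0]mxE !dE; congr (_, _); lia.
(* On this arm the s-coordinate is m - Q s, which dictates the witness; on the other arm it is P s -
   m. *)
- move=> [z1 z2]; rewrite /line /= => zE z10 z20; exists (Q s + z1); first by lia.
  by rewrite /pi_st !dE; congr (_, _); lia.
- move=> [z1 z2]; rewrite /line /= => zE z10 z20; exists (P s - z1); first by lia.
  by rewrite /pi_st !dE; congr (_, _); lia.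
Qed.

End Fan.

Lemma isomorphic_dimvec (F : fieldType) n (Q : quiver n) (V W : rep F Q) :
  isomorphic V W -> dimvec V = dimvec W.
Proof.
move=> [f [_ fiso]]; apply/matrixP => i j; rewrite !mxE.
by have /andP[/eqP rV /eqP rW] := fiso i; rewrite -[in LHS]rV rW.
Qed.

(** * Sperner's lemma on a grid *)

Theorem proposition9p1 (R : realType) (F : closedFieldType) (p q : nat)
    (hp : (0 < p)%N) (hq : (0 < q)%N)
    (s t : 'I_(p + q))
    (hs : fan s = (Outer 0, Inner 0)) (ht : fan t = (Outer p%:Z, Inner 0))
    (M : ann_arc -> rep F (fan_quiver p q)) (hM : dictionary R M)
    (hC : c_vectors (fan_quiver p q) =
      [set v | exists V : rep F (fan_quiver p q),
                 exceptional V /\ (v = dimvec V \/ v = - dimvec V)]) :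
  (* (1) *)
  (forall g : ann_arc, essential R p q g -> ~ in_fan p q g ->
     [/\ bridging g <-> transjective (M g),
         peripheral g <-> regular (M g),
         (crossing R p q g Core)%:Z = `|defect (fan_quiver p q) (dimvec (M g))| &
         crossing R p q g Core \in [:: 0%N; 1%N]])
  /\
  (* (2) *)
  ((forall g : ann_arc, essential R p q g -> peripheral g ->
      isotopic p q (twist p 1 g) g)
   /\
   (forall g : ann_arc, essential R p q g -> bridging g ->
      let d (m : int) := crossv R p q (twist p m g) in
      (forall i, V_shaped (fun m => d m i 0))
      /\
      (exists K : int, forall m, K <= m ->
         [/\ d (m + 1) = d m + delta,
             d (- m - 1) = d (- m) + delta,
             defect (fan_quiver p q) (d m) = 1 &
             defect (fan_quiver p q) (d (- m)) = -1])))
  /\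
  (* (3) *)
  [/\ (* C(Q) projects to three lines: the off-diagonal ones carry the bridging
         arcs, and the diagonal the arcs disjoint from the core *)
      (forall v, c_vectors (fan_quiver p q) v ->
         exists g : ann_arc,
           [/\ essential R p q g, ~ in_fan p q g,
               v = dimvec (M g) \/ v = - dimvec (M g) &
               ((line 1 (pi_st s t v) \/ line (-1) (pi_st s t v)) /\ bridging g)
               \/ (line 0 (pi_st s t v) /\ crossing R p q g Core = 0%N)]),
      (forall g : ann_arc, essential R p q g -> ~ in_fan p q g ->
         let v := dimvec (M g) in
         [/\ bridging g <-> line 1 (pi_st s t v) \/ line (-1) (pi_st s t v),
             line 1 (pi_st s t v) <-> 0 < defect (fan_quiver p q) v,
             line (-1) (pi_st s t v) <-> defect (fan_quiver p q) v < 0 &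
             line 0 (pi_st s t v) <-> crossing R p q g Core = 0%N]),
      (* the two arms of a twist orbit, the shift along them and the filling of
         the lines; between the arms the orbit lies in the triangulation *)
      (forall g : ann_arc, essential R p q g -> bridging g ->
         let d (m : int) := crossv R p q (twist p m g) in
         exists m0 m1 : int, m0 <= m1 /\
           [/\ (forall m, m0 <= m < m1 -> in_fan p q (twist p m g)),
               (forall m, m1 <= m ->
                  [/\ ~ in_fan p q (twist p m g), line 1 (pi_st s t (d m)) &
                      pi_st s t (d (m + 1)) = pi_st s t (d m + delta)]),
               (forall m, m < m0 ->
                  [/\ ~ in_fan p q (twist p m g), line (-1) (pi_st s t (d m)) &
                      pi_st s t (d (m - 1)) = pi_st s t (d m + delta)]),
               (forall z : int * int, line 1 z -> 0 <= z.1 -> 0 <= z.2 ->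
                  exists2 m, m1 <= m & pi_st s t (d m) = z) &
               (forall z : int * int, line (-1) z -> 0 <= z.1 -> 0 <= z.2 ->
                  exists2 m, m < m0 & pi_st s t (d m) = z)]),
      (line 1 `|` line (-1) `<=` pi_st s t @` c_vectors (fan_quiver p q)) &
      (* finitely many arcs on the diagonal *)
      (exists (N : nat) (l : 'I_N -> ann_arc), forall g : ann_arc, essential R p q g -> ~ in_fan p q g ->
         line 0 (pi_st s t (dimvec (M g))) ->
         exists j, isotopic p q (l j) g)].
Proof.
have dim g : essential R p q g -> ~ in_fan p q g -> dimvec (M g) = crossv R p q g.
  by move=> ge gf; apply/matrixP => i j; rewrite !mxE (dict_dim hM ge gf).
have defE g : essential R p q g -> ~ in_fan p q g ->
    defect (fan_quiver p q) (dimvec (M g)) = crossv R p q g s 0 - crossv R p q g t 0.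
  by move=> ge gf; rewrite (defect_fan hp hq hs ht) dim.
have bridging_c g : bridging g -> ~ in_fan p q g -> c_vectors (fan_quiver p q) (crossv R p q g) /\
    c_vectors (fan_quiver p q) (- crossv R p q g).
  move=> gb gf; have ge := bridging_essential R p q gb.
  by rewrite -dim // hC; split; exists (M g); split; try exact: (dict_exceptional hM); [left|right].
have oppE (v : 'cV[int]_(p + q)) i : (- v) i 0 = - v i 0 by rewrite mxE.
split; last split.
- move=> g ge gf; have [Mind _] := dict_exceptional hM ge gf.
  rewrite /transjective /preprojective /regular /preinjective /peripheral defE //.
  have [[gb -> e]|[gp -> e]] := essential_dichotomy hp hq hs ht ge gf.
    rewrite gb; split.
    + by split=> // _; case: e => ->; [right|left].
    + by split=> // -[_]; case: e => ->.
    + by case: e => ->.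
    + by [].
  rewrite /peripheral in gp; rewrite gp (negbTE gp) e; split.
  + by split=> // -[] [].
  + by [].
  + by [].
  + by [].
- split=> [g _|g ge gb d]; first exact: twist_peripheral.
  have [P [Q [PQ dE [Pt Qt] _]]] := bridging_orbit R hp hq hs ht gb.
  split=> [i|].
    exists (P i), (Q i); split=> // m; have := PQ i; rewrite /d !dE.
    by split; lia.
  (* One bound beyond the flat parts of all coordinates at once, on both sides. *)
  exists (\sum_i (`|P i| + `|Q i|) + 1) => m mK.
  have bound i : `|P i| + `|Q i| < m.
    apply: lt_le_trans mK; rewrite ltzD1 (bigD1 i) //= lerDl.
    by apply: sumr_ge0 => j _; rewrite addr_ge0.
  have hi i n : m <= n -> d n i 0 = n - Q i by move=> mn; rewrite /d dE; have := bound i; lia.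
  have lo i n : n <= - m -> d n i 0 = P i - n by move=> mn; rewrite /d dE; have := bound i; lia.
  split.
  + by apply/matrixP => i j; rewrite (ord1 j) [RHS]mxE [delta i 0]mxE !hi ?lerDl //; ring.
  + by apply/matrixP => i j; rewrite (ord1 j) [RHS]mxE [delta i 0]mxE !lo ?gerDl //; ring.
  + by rewrite (defect_fan hp hq hs ht) !hi // Qt; ring.
  + by rewrite (defect_fan hp hq hs ht) !lo // Pt; ring.
- split.
  + move=> v; rewrite hC => -[V [Vex vV]].
    have [g [ge gf gV]] := dict_surj hM Vex; exists g.
    rewrite (isomorphic_dimvec gV); split => //; rewrite -(isomorphic_dimvec gV) dim // in vV.
    have [[gb _ e]|[gp -> e]] := essential_dichotomy hp hq hs ht ge gf; [left|right]; split=> //;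
      move: e; rewrite /line /pi_st /=; case: vV => ->; rewrite ?oppE; lia.
  + move=> g ge gf v; rewrite defE // /v dim // /line /pi_st /=.
    have [[gb -> e]|[gp -> e]] := essential_dichotomy hp hq hs ht ge gf.
      by rewrite gb; split; lia.
    by rewrite /peripheral in gp; rewrite (negbTE gp); split; lia.
  + by move=> g _ gb; exact: bridging_arms.
  (* The orbit of one bridging arc already reaches all points with nonnegative coordinates on both
     lines; negation, which exchanges the lines, supplies the rest. *)
  + have [m0 [m1 [_ [_ up dn fup fdn]]]] :=
        bridging_arms R hp hq hs ht (g := (Outer 0, Inner 0)) isT.
    have piN v : pi_st s t (- v) = (- (pi_st s t v).1, - (pi_st s t v).2) by rewrite /pi_st !oppE.
    have upC z : line 1 z -> 0 <= z.1 -> 0 <= z.2 ->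
        (pi_st s t @` c_vectors (fan_quiver p q)) z /\
        (pi_st s t @` c_vectors (fan_quiver p q)) (- z.1, - z.2).
      move=> z1 z10 z20; have [m /up[gf _ _] <-] := fup z z1 z10 z20.
      have [//|cv cvN] := bridging_c _ _ gf.
      by split; [eexists; first exact: cv|eexists; [exact: cvN|exact: piN]].
    have dnC z : line (-1) z -> 0 <= z.1 -> 0 <= z.2 ->
        (pi_st s t @` c_vectors (fan_quiver p q)) z /\
        (pi_st s t @` c_vectors (fan_quiver p q)) (- z.1, - z.2).
      move=> z1 z10 z20; have [m /dn[gf _ _] <-] := fdn z z1 z10 z20.
      have [//|cv cvN] := bridging_c _ _ gf.
      by split; [eexists; first exact: cv|eexists; [exact: cvN|exact: piN]].
    (* Integers differing by 1 are both nonnegative or both nonpositive, so a point with a negative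
       coordinate is the opposite of one on the other line. *)
    move=> [z1 z2] [] zE; have zE' : z1 - z2 = _ := zE; have [z0|z0] := leP 0 (Num.min z1 z2).
    * by apply: (proj1 (upC _ zE _ _)) => /=; lia.
    * have [|||_] := dnC (- z1, - z2); rewrite ?/line /= ?opprK //; lia.
    * by apply: (proj1 (dnC _ zE _ _)) => /=; lia.
    * have [|||_] := upC (- z1, - z2); rewrite ?/line /= ?opprK //; lia.
  + pose T : finType := ('I_p * 'I_(3 * p).+1 + 'I_q * 'I_(3 * q).+1)%type.
    exists #|T|, (fun j => short_arc (enum_val j)) => g ge gf.
    rewrite dim // /line /pi_st /= => e0.
    have [[_ _ e]|[gp _ _]] := essential_dichotomy hp hq hs ht ge gf; first by lia.
    have [[f fr] _] := ge.
    have [w wg] := short_arc_isotopic hp hq (peripheral_same_side_le hp hq fr gp).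
    by exists (enum_rank w); rewrite enum_rankK.
Qed.
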